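(* Let $A=(b_0,b_1,b_2,\dots)$ be an infinite sequence of independent, identically distributed real random variables with common distribution $p$ having mean $0$, variance $1$, and finite moments of all higher orders. For each $N\ge 1$ let $H_N$ be the $N\times N$ circulant Hankel matrix populated by $b_0,\dots,b_{N-1}$, and let $\mu_{A,N}$ be its empirical spectral measure. Then, almost surely, as $N\to\infty$ the measures $\mu_{A,N}$ converge (weakly) to the symmetrized Rayleigh distribution, i.e. the probability measure on $\mathbb{R}$ with density $f(x)=|x|e^{-x^2}$.
   Context: The $N\times N$ circulant Hankel matrix populated by $b_0,\dots,b_{N-1}$ is $H_N=(h_{ij})_{0\le i,j\le N-1}$ with $h_{ij}=b_{(i+j)\bmod N}$; it is real symmetric. If $\lambda_1(H_N),\dots,\lambda_N(H_N)$ denote its eigenvalues counted with multiplicity, its empirical spectral measure is $$\mu_{A,N}=\frac1N\sum_{i=1}^N \delta_{\lambda_i(H_N)/\sqrt N},$$ where $\delta_y$ is the unit point mass at $y$. The same infinite sequence $A$ is used for all $N$. *)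

(* Defs.v *)
From HB Require Import structures.
From mathcomp Require Import all_boot all_order all_algebra finmap.
From mathcomp Require Import complex.
From mathcomp Require Import all_classical all_reals all_analysis measurable_realfun.

Set Implicit Arguments.
Unset Strict Implicit.
Unset Printing Implicit Defensive.

Import Order.TTheory GRing.Theory Num.Theory.
Import numFieldNormedType.Exports.

Local Open Scope classical_set_scope.
Local Open Scope ring_scope.

Section circulant_hankel.
Context {R : realType}.

Definition circulant_hankel (N : nat) (b : nat -> R) : 'M[R]_N :=
  \matrix_(i < N, j < N) b ((i + j) %% N)%N.

Lemma circulant_hankel_sym N b : (circulant_hankel N b)^T = circulant_hankel N b.
Proof. by apply/matrixP => i j; rewrite !mxE addnC. Qed.

End circulant_hankel.

Section spectrum.
Context {R : realType}.

(* The eigenvalues of M with multiplicity, as the roots of its characteristic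
   polynomial.  The sequence is determined up to a permutation when the
   polynomial splits over R, which holds for every symmetric M by
   char_poly_eigenvalues below. *)
Definition eigenvalues n (M : 'M[R]_n) : seq R :=
  xget [::] [set s : seq R | char_poly M = \prod_(z <- s) ('X - z%:P)].

Lemma char_poly_eigenvalues n (M : 'M[R]_n) : M^T = M ->
  char_poly M = \prod_(z <- eigenvalues M) ('X - z%:P).
Proof.
move=> Msym; apply: (@xgetPex _ [::]
  [set s : seq R | char_poly M = \prod_(z <- s) ('X - z%:P)]).
pose toC := real_complex R; pose A := map_mx toC M.
have Aherm : A \is hermsymmx.
  apply/is_hermitianmxP; rewrite expr0 scale1r; apply/matrixP => i j.
  by rewrite !mxE -[in LHS]Msym mxE; apply/esym/CrealP/complex_realP; exists (M j i).
have /hermitian_normalmx/orthomx_spectralP := Aherm.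
have := hermitian_spectral_diag_real Aherm.
have := spectral_unit A; set Q := spectralmx A; set D := spectral_diag A.
move=> Qunit Dreal AE; exists [seq complex.Re (D 0 i) | i <- enum 'I_n].
apply: (map_poly_inj toC); rewrite map_char_poly -/A.
have -> : char_poly A = char_poly (diag_mx D).
  have AQ : Q *m A = diag_mx D *m Q by rewrite AE !mulmxA mulmxV// mul1mx.
  have chQ : map_mx polyC Q *m char_poly_mx A =
      char_poly_mx (diag_mx D) *m map_mx polyC Q.
    rewrite /char_poly_mx mulmxBr mulmxBl -!map_mxM AQ.
    by rewrite scalar_mxC.
  have /(congr1 determinant) := chQ; rewrite !det_mulmx mulrC.
  apply: mulIf; rewrite det_map_mx polyC_eq0.
  by rewrite -unitfE -unitmxE.
rewrite char_poly_trig ?diag_mx_is_trig// big_map rmorph_prod/= big_enum/=.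
apply: eq_bigr => i _; rewrite mxE eqxx mulr1n map_polyXsubC.
congr ('X - _%:P); apply/esym/RRe_real.
by move/mxOverP : Dreal; exact.
Qed.

Lemma size_eigenvalues n (M : 'M[R]_n) : M^T = M -> size (eigenvalues M) = n.
Proof.
move=> /char_poly_eigenvalues /(congr1 (fun p : {poly R} => size p)).
by rewrite size_char_poly size_prod_XsubC => -[].
Qed.

End spectrum.

Section measures.
Context {R : realType}.

(* For n = 0 this is the zero measure, since 0^-1 = 0; it is a probability
   measure for n > 0.  For symmetric M, the index i < n runs over the whole
   sequence of eigenvalues by size_eigenvalues. *)
Definition empirical_spectral_measure n (M : 'M[R]_n) :
    {measure set (measurableTypeR R) -> \bar R} :=
  mscale (n%:R^-1)%:nng
    (msum (fun i => \d_((eigenvalues M)`_i / Num.sqrt n%:R : measurableTypeR R)) n).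

Definition weakly_converges
    (mu_ : nat -> {measure set (measurableTypeR R) -> \bar R})
    (mu : {measure set (measurableTypeR R) -> \bar R}) : Prop :=
  forall f : R -> R, continuous f -> bounded_fun f ->
    (\int[mu_ n]_x (f x)%:E)%E @[n --> \oo] --> (\int[mu]_x (f x)%:E)%E.

End measures.

Definition mutually_independent d (T : measurableType d) (R : realType)
    (P : probability T R) (X : nat -> {RV P >-> R}) : Prop :=
  forall (J : {fset nat}) (A : nat -> set R),
    (forall i, measurable (A i)) ->
    P (\bigcap_(i in [set` J]) X i @^-1` A i) =
    (\prod_(i <- J) P (X i @^-1` A i))%E.

Definition symmetrized_rayleigh_pdf {R : realType} (x : R) : R :=
  `|x| * expR (- x ^+ 2).

Definition symmetrized_rayleigh {R : realType}
    (V : set (measurableTypeR R)) : \bar R :=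
  (\int[lebesgue_measure]_(x in V) (symmetrized_rayleigh_pdf x)%:E)%E.

Section symmetrized_rayleigh_probability.
Context {R : realType}.
Notation mu := (@lebesgue_measure R).
Notation pdf := (@symmetrized_rayleigh_pdf R).
Notation ray := (@symmetrized_rayleigh R).

Lemma symmetrized_rayleigh_pdf_ge0 x : 0 <= pdf x.
Proof. by rewrite mulr_ge0 ?expR_ge0. Qed.

Lemma continuous_symmetrized_rayleigh_pdf : continuous pdf.
Proof.
move=> x; apply: cvgM; last exact: (@continuous_gauss_fun R).
exact: norm_continuous.
Qed.

Lemma measurable_symmetrized_rayleigh_pdf : measurable_fun [set: R] pdf.
Proof.
apply: measurable_funM; last exact: measurable_gauss_fun.
exact: normr_measurable.
Qed.

Lemma integral_symmetrized_rayleigh_pdf : (\int[mu]_x (pdf x)%:E = 1)%E.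
Proof.
rewrite ge0_symfun_integralT//=; first last.
- by move=> x; rewrite /symmetrized_rayleigh_pdf/= normrN sqrrN.
- exact: continuous_symmetrized_rayleigh_pdf.
- exact: symmetrized_rayleigh_pdf_ge0.
pose F (x : R) : R := - (2^-1 * gauss_fun x).
have dF (x : R) : is_derive x 1 F (x * gauss_fun x).
  have dX : is_derive x 1 (fun y : R => - y ^+ 2) (- (2 * x)).
    by apply: is_derive_eq; rewrite /GRing.scale/= mulr1 mulr_natl.
  have -> : x * gauss_fun x = - (2^-1 *: (expR (- x ^+ 2) * - (2 * x))).
    rewrite /gauss_fun /GRing.scale/= mulrN mulrN opprK mulrCA [RHS]mulrC.
    by rewrite mulKf.
  by apply: is_deriveN; apply: is_deriveZ.
have cF : continuous F.
  by move=> x; apply: cvgN; apply: cvgMr; exact: continuous_gauss_fun.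
rewrite (_ : [set x | _] = `[0, +oo[%classic); last first.
  by apply/seteqP; split => x/=; rewrite in_itv/= andbT.
rewrite (@ge0_continuous_FTC2y _ _ F _ 0)//.
- rewrite /F /gauss_fun expr0n/= oppr0 expR0 mulr1 -EFinB -EFinM sub0r opprK.
  by rewrite divff.
- by move=> x _; exact: symmetrized_rayleigh_pdf_ge0.
- by apply: continuous_subspaceT; exact: continuous_symmetrized_rayleigh_pdf.
- rewrite -oppr0 -(mulr0 2^-1); apply: cvgN; apply: cvgMr.
  exact: cvg_gauss_fun.
- by apply: cvg_at_right_filter; exact: cF.
- move=> x; rewrite in_itv/= andbT => x0.
  by rewrite derive1E (@derive_val _ _ _ _ _ _ _ (dF x)) /symmetrized_rayleigh_pdf gtr0_norm.
Qed.

Let symmetrized_rayleigh0 : ray set0 = 0%E.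
Proof. by rewrite /symmetrized_rayleigh integral_set0. Qed.

Let symmetrized_rayleigh_ge0 A : (0 <= ray A)%E.
Proof.
by apply: integral_ge0 => x _; rewrite lee_fin symmetrized_rayleigh_pdf_ge0.
Qed.

Let symmetrized_rayleigh_sigma_additive : semi_sigma_additive ray.
Proof.
move=> /= F mF tF mUF; rewrite /symmetrized_rayleigh; apply: cvg_toP.
  apply: ereal_nondecreasing_is_cvgn => m n mn.
  apply: lee_sum_nneg_natr => // k _ _; exact: symmetrized_rayleigh_ge0.
rewrite ge0_integral_bigcup//=.
- apply/measurable_funTS/measurableT_comp => //.
  exact: measurable_symmetrized_rayleigh_pdf.
- by move=> x _; rewrite lee_fin symmetrized_rayleigh_pdf_ge0.
Qed.

HB.instance Definition _ := isMeasure.Build _ _ _ ray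
  symmetrized_rayleigh0 symmetrized_rayleigh_ge0
  symmetrized_rayleigh_sigma_additive.

Let symmetrized_rayleigh_setT : ray [set: _] = 1%E.
Proof. exact: integral_symmetrized_rayleigh_pdf. Qed.

HB.instance Definition _ :=
  @Measure_isProbability.Build _ _ R ray symmetrized_rayleigh_setT.

End symmetrized_rayleigh_probability.

(* Main.v *)
(** The discrete Fourier transform [B_k] of [b] diagonalises the matrix in pairs:
    the eigenvalues are [|B_k|] and [-|B_k|] for the frequencies [k] and [N - k],
    up to the at most two frequencies with [2 k = 0 mod N].  Hence the empirical
    measure is, up to [O(1/N)], the symmetrisation of the law of [sqrt Y_k] for a
    uniform frequency [k], where [Y_k = |B_k|^2 / N].  It remains to show that the
    empirical law of the [Y_k] tends to the exponential law, i.e. that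
    [Phi (n) = N^-1 sum_k exp (- n Y_k)] tends to [1 / (n + 1)] for every natural
    number [n]: a bounded continuous even function times [1 - (1 - u)^m] is a
    continuous function of [u = exp (- x^2)] in [[0, 1]], hence a uniform limit of
    polynomials in [u].

    For the latter, [d/ds ((1 + s) Phi (s))] is the average [D_s] of
    [(1 - (1 + s) Y_k) exp (- s Y_k)], and up to [O(1/N)]
    [N D_s = sum_j (d V_j / d b_j - b_j V_j)] for an explicit field [V].  If the
    entries were Gaussian, integration by parts would give [E D_s = O(1/N)]; in
    general, comparing with the sample in which [b_j] is replaced by [0], which is
    independent of [b_j], gives for [X = Phi (n) - 1 / (n + 1)]
    [|E (X^(2m+1) D_s)| <= C N^(-1/2) (E X^(2m) + N^(-m))] uniformly in
    [s] in [[0, n]].  Integrating over [s] gives [E X^(2m) = O(N^(-m/2))] for all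
    [m] by induction, and [m = 4] makes the series of the [E X^8] summable. *)
Require Import Defs.
From HB Require Import structures.
From mathcomp Require Import all_boot all_order all_algebra finmap.
From mathcomp Require Import all_classical all_reals all_analysis measurable_realfun.
From mathcomp Require Import ring lra zify.

Set Implicit Arguments.
Unset Strict Implicit.
Unset Printing Implicit Defensive.

Import Order.TTheory GRing.Theory Num.Theory.
Import numFieldNormedType.Exports.

Local Open Scope classical_set_scope.
Local Open Scope ring_scope.

(** * Trigonometric sums *)

Section circle_sums.
Context {R : realType}.

(** The exponential law enters because its Laplace transform [1 / (1 + s)] is the solution of
    [d/ds ((1 + s) Phi (s)) = 0] with [Phi (0) = 1]. Without Gaussian entries the [B_k] are neither
    normal nor independent, and almost sure convergence of an average over all frequencies needs a
    quantitative rate; this is why moments of [X] are estimated. The odd power [X^(2m+1)] is kept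
    fixed while [s] runs, so the integral over [s] equals [(n + 1) E X^(2m+2)]: a bound on [D_s]
    raises the moment by two and gains one factor [N^(-1/2)]. The difficulty is that a single
    component [V_j] has no good bound. Only [sum_j V_j^2 <= sum_j b_j^2] is used, which needs one
    sample common to all [j], whereas factoring out [b_j] needs the sample without [b_j]. Hence the
    estimates carry weights and move back and forth between the two samples. The summand [N^(-m)]
    added to [X^(2m)] absorbs the change of [X] in such a move. *)

Definition fourier_angle (N m : nat) : R := m%:R * (2 * pi / N%:R).

Lemma fourier_angleD N m n :
  fourier_angle N (m + n) = fourier_angle N m + fourier_angle N n.
Proof. by rewrite /fourier_angle natrD mulrDl. Qed.

Lemma fourier_angle_mull N m n :
  fourier_angle N (m * n) = m%:R * fourier_angle N n.
Proof. by rewrite /fourier_angle natrM -mulrA. Qed.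

Lemma fourier_angle_period N q : (0 < N)%N -> fourier_angle N (q * N) = (pi *+ 2) *+ q.
Proof.
move=> N0; rewrite /fourier_angle natrM -[RHS]mulr_natl -mulr_natl.
by field; rewrite pnatr_eq0 -lt0n.
Qed.

Lemma cos_fourier_angle_period N q a : (0 < N)%N ->
  cos (a + fourier_angle N (q * N)) = cos a.
Proof. by move=> N0; rewrite fourier_angle_period// (periodicn (@cosD2pi R)). Qed.

Lemma sin_fourier_angle_period N q a : (0 < N)%N ->
  sin (a + fourier_angle N (q * N)) = sin a.
Proof. by move=> N0; rewrite fourier_angle_period// (periodicn (@sinD2pi R)). Qed.

(** Multiples of [pi] only change the sign of the sine, so [m] may be reduced modulo [N]; the half
    angle then lies strictly between [0] and [pi]. *)
Lemma sin_half_fourier_angle_neq0 N m : (0 < N)%N -> ~~ (N %| m)%N ->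
  sin (fourier_angle N m / 2) != 0 :> R.
Proof.
move=> N0 Nm.
have N0R : 0 < N%:R :> R by rewrite ltr0n.
have -> : fourier_angle N m / 2 = (m %% N)%N%:R / N%:R * pi + pi *+ (m %/ N).
  rewrite /fourier_angle {1}(divn_eq m N) natrD natrM -mulr_natr.
  by field; rewrite lt0r_neq0.
rewrite (alternatingn (@sinDpi R)) mulf_neq0 ?signr_eq0// lt0r_neq0//.
apply: sin_gt0_pi; rewrite mulr_gt0 ?pi_gt0 ?divr_gt0 ?ltr0n//=.
  by rewrite gtr_pMl ?pi_gt0// ltr_pdivrMr// mul1r ltr_nat ltn_mod.
by rewrite lt0n.
Qed.

(** Multiplied by [2 * sin (x / 2)], each cosine is a difference of sines at two consecutive half
    steps, and the sum telescopes. *)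
Lemma sum_cos_progression n (x a : R) :
  2 * sin (x / 2) * \sum_(j < n) cos (j%:R * x + a) =
  sin (n%:R * x - x / 2 + a) - sin (- (x / 2) + a).
Proof.
elim: n => [|n IHn]; first by rewrite big_ord0 mulr0 mul0r add0r subrr.
rewrite big_ord_recr/= mulrDr IHn.
have -> : n.+1%:R * x - x / 2 + a = (n%:R * x + a) + x / 2.
  by rewrite -natr1; field.
have -> : n%:R * x - x / 2 + a = (n%:R * x + a) - x / 2 by field.
by rewrite sinB (sinD (_ + a)); ring.
Qed.

Lemma sum_cos_fourier_angle N m (a : R) : (0 < N)%N -> ~~ (N %| m)%N ->
  \sum_(j < N) cos (fourier_angle N (j * m) + a) = 0.
Proof.
move=> N0 Nm; have s0 := sin_half_fourier_angle_neq0 N0 Nm.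
under eq_bigr do rewrite fourier_angle_mull.
have c0 : 2 * sin (fourier_angle N m / 2) != 0 :> R by rewrite mulf_neq0.
apply: (mulfI c0).
rewrite sum_cos_progression mulr0 -fourier_angle_mull mulnC.
rewrite addrAC -addrA addrC sin_fourier_angle_period//.
by rewrite addrC subrr.
Qed.

Lemma sum_cos_fourier_angleB N k l (a : R) : (k < N)%N -> (l < N)%N -> k != l ->
  \sum_(j < N) cos (fourier_angle N (j * k) - fourier_angle N (j * l) + a) = 0.
Proof.
move=> kN lN kl; have N0 : (0 < N)%N by case: N kN {lN}.
(* The frequency [k - l] is represented by the natural number [k + (N - l)], which changes the angle
   by [j] full turns. *)
rewrite -[RHS](@sum_cos_fourier_angle N (k + (N - l)) a)//; last first.
  apply/negP => /dvdnP[q qE]; move/negP: kl; apply; apply/eqP.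
  by case: q qE => [|[|q]] qE; nia.
apply: eq_bigr => j _.
rewrite -[LHS](@cos_fourier_angle_period N j)//; congr cos.
have -> : (j * (k + (N - l)) = j * k + j * (N - l))%N by rewrite mulnDr.
have -> : (j * N = j * (N - l) + j * l)%N by rewrite -mulnDr subnK// ltnW.
by rewrite !fourier_angleD; ring.
Qed.

Lemma sum_sqr_cos_fourier_angle N (k : nat) (a : R) : (0 < N)%N -> ~~ (N %| k.*2)%N ->
  \sum_(j < N) cos (fourier_angle N (j * k) + a) ^+ 2 = N%:R / 2.
Proof.
move=> N0 Nk.
rewrite (eq_bigr (fun j : 'I_N => 2^-1 +
    2^-1 * cos (fourier_angle N (j * k.*2) + a *+ 2))); last first.
  move=> j _; have -> : fourier_angle N (j * k.*2) + a *+ 2 =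
      (fourier_angle N (j * k) + a) *+ 2.
    by rewrite -muln2 mulnA muln2 -addnn fourier_angleD mulr2n mulr2n; ring.
  by rewrite cos_mulr2n; field.
rewrite big_split/= -mulr_sumr sum_cos_fourier_angle// mulr0 addr0.
by rewrite sumr_const card_ord -[LHS]mulr_natl.
Qed.

Lemma parseval N (x : 'I_N -> R) :
  \sum_(k < N) ((\sum_(j < N) x j * cos (fourier_angle N (j * k))) ^+ 2 +
                (\sum_(j < N) x j * sin (fourier_angle N (j * k))) ^+ 2) =
  N%:R * \sum_(j < N) x j ^+ 2.
Proof.
rewrite (eq_bigr (fun k : 'I_N => \sum_(i < N) \sum_(j < N) x i * x j *
   cos (fourier_angle N (k * i) - fourier_angle N (k * j) + 0))); last first.
  move=> k _; rewrite !expr2 !mulr_suml -big_split/=; apply: eq_bigr => i _.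
  rewrite !mulr_sumr -big_split/=; apply: eq_bigr => j _.
  by rewrite addr0 cosB !(mulnC k); ring.
rewrite exchange_big/= mulr_sumr; apply: eq_bigr => i _.
rewrite exchange_big/= (bigD1 i)//= [X in _ + X]big1 ?addr0; last first.
  by move=> j ji; rewrite -mulr_sumr sum_cos_fourier_angleB ?mulr0// eq_sym.
under eq_bigr do rewrite subrr addr0 cos0 mulr1.
by rewrite sumr_const card_ord -expr2 -[LHS]mulr_natl.
Qed.

Lemma sum_ord_eq_le1 N m : \sum_(k < N) ((k == m :> nat)%:R : R) <= 1.
Proof.
have [mN|mN] := ltnP m N.
  rewrite (bigD1 (Ordinal mN))//= eqxx big1 ?addr0// => k kN.
  by rewrite (_ : (k == m :> nat) = false)//; apply: negbTE.
rewrite big1 ?ler01// => k _.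
by have := ltn_ord k; case: eqP => // -> ; rewrite ltnNge mN.
Qed.

(** As [k.*2 < 2 N], divisibility by [N] leaves only [k = 0] and [k = N./2]. *)
Lemma sum_self_dual_le2 N : (0 < N)%N -> \sum_(k < N) ((N %| k.*2)%N%:R : R) <= 2.
Proof.
move=> N0; apply: (@le_trans _ _ (\sum_(k < N) (((k == 0%N :> nat)%:R : R) +
    (k == N./2 :> nat)%:R))).
  apply: ler_sum => k _; have [/dvdnP[q qE]|Nk] := boolP (N %| k.*2)%N.
    rewrite -natrD -[leLHS]/(1%:R) ler_nat; have kN := ltn_ord k.
    case: q qE => [|[|q]] qE.
    - by rewrite (_ : k = 0%N :> nat)//; lia.
    - by rewrite (_ : k = N./2 :> nat) ?eqxx ?addn1//; lia.
    - by nia.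
  by rewrite addr_ge0.
rewrite big_split/= (_ : 2 = 1 + 1 :> R)//.
by apply: lerD; exact: sum_ord_eq_le1.
Qed.

End circle_sums.

(** * The spectrum of a circulant Hankel matrix *)

Section polar.
Context {R : realType}.

Lemma polar_coordinates (x y : R) : exists a,
  x = Num.sqrt (x ^+ 2 + y ^+ 2) * cos a /\ y = Num.sqrt (x ^+ 2 + y ^+ 2) * sin a.
Proof.
set r := Num.sqrt _.
have r2 : r ^+ 2 = x ^+ 2 + y ^+ 2 by rewrite sqr_sqrtr// addr_ge0// sqr_ge0.
have [r0|r0] := eqVneq r 0.
  move: r2; rewrite r0 expr0n/= => /esym/eqP.
  rewrite paddr_eq0 ?sqr_ge0// !sqrf_eq0 => /andP[/eqP-> /eqP->].
  by exists 0; rewrite !mul0r.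
have xr : `|x / r| <= 1.
  rewrite -(ler_pXn2r (n := 2))// ?nnegrE// real_normK ?num_real// expr1n.
  rewrite expr_div_n ler_pdivrMr ?exprn_even_gt0//= mul1r r2.
  by rewrite lerDl sqr_ge0.
have xr' : -1 <= x / r <= 1 by rewrite -ler_norml.
have yr : (y / r) ^+ 2 = 1 - (x / r) ^+ 2.
  by rewrite !expr_div_n r2; field; rewrite -r2 sqrf_eq0.
have rp : 0 < r by rewrite lt0r r0 sqrtr_ge0.
have acosE : r * cos (acos (x / r)) = x by rewrite acosK ?in_itv//= mulrC mulfVK.
have asinE : r * sin (acos (x / r)) = `|y|.
  rewrite sin_acos// -yr sqrtr_sqr normf_div (gtr0_norm rp).
  by rewrite mulrC mulfVK.
have [y0|y0] := leP 0 y.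
  by exists (acos (x / r)); rewrite acosE asinE ger0_norm.
by exists (- acos (x / r)); rewrite cosN sinN mulrN acosE asinE ltr0_norm ?opprK.
Qed.

End polar.

Section circulant_hankel_spectrum.
Context {R : realType} (n : nat).
Local Notation N := n.+1.
Variable b : nat -> R.

Local Notation ang := (@fourier_angle R N).

Definition dft_cos (k : nat) : R := \sum_(j < N) b j * cos (ang (j * k)).
Definition dft_sin (k : nat) : R := \sum_(j < N) b j * sin (ang (j * k)).
Definition dft_norm (k : nat) : R := Num.sqrt (dft_cos k ^+ 2 + dft_sin k ^+ 2).

(** Translation by [i] in the cyclic group ['I_N] turns row [i] into the sequence itself and
    reverses the sign of the angle. A cosine of phase [a] is therefore an eigenvector as soon as the
    argument of the Fourier coefficient is [a *+ 2], up to the sign of the eigenvalue. *)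
Lemma circulant_hankel_cos (k : 'I_N) (a : R) (i : 'I_N) :
  \sum_(j < N) circulant_hankel N b i j * cos (ang (j * k) - a) =
  dft_cos k * cos (ang (i * k) + a) + dft_sin k * sin (ang (i * k) + a).
Proof.
rewrite /dft_cos /dft_sin !mulr_suml -big_split/=.
rewrite [RHS](reindex_inj (addrI i))/=; apply: eq_bigr => j _.
rewrite mxE /= -!mulrA -mulrDr; congr (_ * _).
rewrite -cosB.
rewrite -[RHS](@cos_fourier_angle_period R N (((i + j) %/ N) * k))//; congr cos.
have -> : ang (j * k) = ang ((i + j) * k) - ang (i * k).
  by rewrite mulnDl fourier_angleD addrC addKr.
rewrite [in LHS](divn_eq (i + j) N) (mulnDl _ _ k) fourier_angleD.
by rewrite (mulnAC _ N); ring.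
Qed.

Lemma ord_opp_double (k : 'I_N) : (N %| k.*2)%N = false -> (- k)%R = (N - k)%N :> nat.
Proof.
move=> Nk /=; rewrite modn_small// ltn_subrL lt0n /=.
by apply/andP; split => //; apply/eqP => k0; rewrite k0 dvdn0 in Nk.
Qed.

Lemma dft_oppr (k : 'I_N) :
  dft_cos (- k)%R = dft_cos k /\ dft_sin (- k)%R = - dft_sin k.
Proof.
have E (j : nat) : exists q : nat, ang (j * (- k)%R) = - ang (j * k) + ang (q * N).
  have [k0|k0] := posnP k.
    by exists 0%N; rewrite /= k0 subn0 modnn muln0 mul0n /fourier_angle mul0r oppr0 addr0.
  exists j; rewrite /= modn_small ?ltn_subrL ?k0//.
  have -> : (j * N = j * (N - k) + j * k)%N by rewrite -mulnDr subnK// ltnW.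
  by rewrite fourier_angleD; ring.
rewrite /dft_cos /dft_sin -sumrN; split; apply: eq_bigr => j _.
  by have [q ->] := E j; rewrite cos_fourier_angle_period// cosN.
by have [q ->] := E j; rewrite sin_fourier_angle_period// sinN mulrN.
Qed.

Lemma dft_norm_oppr (k : 'I_N) : dft_norm (- k)%R = dft_norm k.
Proof. by rewrite /dft_norm; have [-> ->] := dft_oppr k; rewrite sqrrN. Qed.

Lemma dft_sin_self_dual (k : 'I_N) : (N %| k.*2)%N -> dft_sin k = 0.
Proof.
move=> /dvdnP[q qE]; have kk : (- k)%R = k.
  apply/val_inj => /=; have [k0|k0] := posnP k; first by rewrite k0 subn0 modnn.
  rewrite modn_small ?ltn_subrL ?k0//.
  by have := ltn_ord k; case: q qE => [|[|q]] qE; nia.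
have [_] := dft_oppr k; rewrite kk => /eqP.
by rewrite -addr_eq0 -mulr2n mulrn_eq0/= => /eqP.
Qed.

(* The eigenvector of the frequency [k] is [cos (2 pi j k / N - phase k)]; for
   [2 k > N] the phase is shifted by a quarter turn with respect to that of
   [N - k], which makes the eigenvalue negative and the vectors orthogonal. *)
Lemma hankel_phase : exists eta phase : 'I_N -> R, forall k : 'I_N,
  [/\ dft_cos k = eta k * cos (phase k *+ 2),
      dft_sin k = eta k * sin (phase k *+ 2),
      (N %| k.*2)%N -> phase k = 0 /\ `|eta k| = dft_norm k &
      (N %| k.*2)%N = false -> phase (- k)%R = pi / 2 - phase k /\
        eta k = (if (k.*2 < N)%N then dft_norm k else - dft_norm k)].
Proof.
have /choice[a aP] : forall k : nat, exists a,
    dft_cos k = dft_norm k * cos a /\ dft_sin k = dft_norm k * sin a.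
  by move=> k; exact: polar_coordinates.
exists (fun k : 'I_N => if (N %| k.*2)%N then dft_cos k
  else if (k.*2 < N)%N then dft_norm k else - dft_norm k).
exists (fun k : 'I_N => if (N %| k.*2)%N then 0
  else if (k.*2 < N)%N then a k / 2 else pi / 2 - a (- k)%R / 2).
move=> k; have := @dft_sin_self_dual k; case: ifPn => Nk s0.
  split => //; first by rewrite mul0rn cos0 mulr1.
  - by rewrite mul0rn sin0 mulr0 s0.
  - by rewrite /dft_norm s0// expr0n/= addr0 sqrtr_sqr.
have Nk' : (N %| k.*2)%N = false by apply/negbTE.
have kE := ord_opp_double Nk'.
have NNk : (N %| ((- k)%R : 'I_N).*2)%N = false.
  apply/negbTE/dvdnP => -[q]; rewrite kE => qE; move/dvdnP: Nk; apply.
  by exists (2 - q)%N; have := ltn_ord k; nia.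
have half (x : R) : (x / 2) *+ 2 = x by rewrite -mulr_natr mulfVK.
have kNN : (k.*2 == N) = false by apply/eqP => E; rewrite E dvdnn in Nk.
rewrite NNk kE; case: ifPn => k2.
- have -> : ((N - k).*2 < N)%N = false by lia.
  have [cE sE] := aP k.
  by split => //; rewrite ?half// opprK => _; split => //; rewrite opprK.
- have -> : ((N - k).*2 < N)%N by have := ltn_ord k; lia.
  have [] := aP (- k)%R; have [-> ->] := dft_oppr k; rewrite dft_norm_oppr kE => cE sE.
  rewrite mulrnBl half; split => //; rewrite ?half.
  + by rewrite cosB cospi sinpi cE; ring.
  + by rewrite sinB cospi sinpi -[LHS]opprK sE; ring.
  + by move=> _; rewrite opprB addrCA subrr addr0.
Qed.

(** The phase-shifted cosines form a matrix [G] with [H G = G D] and with orthogonal nonzero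
    columns. Hence [G] is invertible, [H] and [D] have the same characteristic polynomial, and its
    factorisation into linear factors is unique up to order. *)
Lemma circulant_hankel_eigenvalues : exists eta : 'I_N -> R,
  perm_eq (eigenvalues (circulant_hankel N b)) [seq eta k | k <- enum 'I_N] /\
  forall k : 'I_N, if (N %| k.*2)%N then `|eta k| = dft_norm k else
    eta k = (if (k.*2 < N)%N then dft_norm k else - dft_norm k).
Proof.
have [eta [phase H]] := hankel_phase.
pose H_N := circulant_hankel N b.
pose G : 'M[R]_N := \matrix_(i, k) cos (ang (i * k) - phase k).
pose D : 'M[R]_N := diag_mx (\row_k eta k).
have HG : H_N *m G = G *m D.
  apply/matrixP => i k; rewrite mul_mx_diag !mxE.
  under eq_bigr do rewrite [G _ _]mxE.
  rewrite circulant_hankel_cos; have [-> -> _ _] := H k.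
  rewrite -!mulrA -mulrDr -cosB mulrC; congr (_ * _).
  by rewrite -cosN; congr cos; rewrite mulr2n; ring.
have GG : G^T *m G = diag_mx (\row_k (\sum_j G j k ^+ 2)).
  apply/matrixP => k l; rewrite !mxE; have [<-|kl] := eqVneq k l.
    by rewrite mulr1n; apply: eq_bigr => j _; rewrite mxE expr2.
  rewrite mulr0n (eq_bigr (fun j : 'I_N => 2^-1 *
      (cos (ang (j * (k + l)) + - (phase k + phase l)) +
       cos (ang (j * k) - ang (j * l) + (phase l - phase k))))); last first.
    move=> j _; rewrite !mxE mulnDr fourier_angleD.
    have -> : ang (j * k) + ang (j * l) + - (phase k + phase l) =
      (ang (j * k) - phase k) + (ang (j * l) - phase l) by ring.
    have -> : ang (j * k) - ang (j * l) + (phase l - phase k) =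
      (ang (j * k) - phase k) - (ang (j * l) - phase l) by ring.
    move: (_ - phase k) (_ - phase l) => x y.
    by rewrite cosB cosD; field.
  rewrite -mulr_sumr big_split/= sum_cos_fourier_angleB// addr0.
  (* The product formula leaves the frequency [k + l], which is trivial only for [l = - k]. There
     the two phases add up to [pi / 2], so each cosine becomes the sine of a whole number of
     turns. *)
  have [Nkl|Nkl] := boolP (N %| k + l)%N; last by rewrite sum_cos_fourier_angle// mulr0.
  have lE : l = (- k)%R.
    move/dvdnP : Nkl => [q qE]; apply/val_inj => /=.
    have := ltn_ord k; have := ltn_ord l; have [k0|k0] := posnP k => lN kN.
      rewrite k0 subn0 modnn; rewrite k0 add0n in qE.
      by case: q qE => [|q] qE; nia.
    by rewrite modn_small ?ltn_subrL ?k0//; case: q qE => [|[|q]] qE; nia.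
  have Nk : (N %| k.*2)%N = false.
    apply: contraNF kl => /dvdnP[q qE]; rewrite lE; apply/eqP/val_inj => /=.
    have kN := ltn_ord k; have [k0|k0] := posnP k; first by rewrite k0 subn0 modnn.
    by rewrite modn_small ?ltn_subrL ?k0//; case: q qE => [|[|q]] qE; nia.
  have [_ _ _ /(_ Nk)[pk _]] := H k.
  rewrite lE pk (_ : phase k + (pi / 2 - phase k) = pi / 2); last by ring.
  rewrite big1 ?mulr0// => j _; rewrite cosBpihalf -lE.
  move/dvdnP : Nkl => [q ->]; rewrite mulnA -[fourier_angle _ _]add0r.
  by rewrite sin_fourier_angle_period// sin0.
have Gunit : G \in unitmx.
  rewrite unitmxE unitfE -sqrf_eq0 expr2 -[X in X * _]det_tr -det_mulmx GG.
  rewrite det_diag; apply/prodf_neq0 => k _; rewrite mxE.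
  (* A self-dual column has phase [0], so its entry in row [0] is [1]; any other column has squared
     norm [N / 2]. *)
  have [Nk|Nk] := boolP (N %| k.*2)%N.
    have [_ _ /(_ Nk)[p0 _] _] := H k.
    rewrite (bigD1 0)//= mxE /= mul0n p0 subr0 /fourier_angle mul0r cos0 expr1n.
    by rewrite gt_eqF// ltr_pwDl// sumr_ge0// => j _; rewrite sqr_ge0.
  under eq_bigr do rewrite mxE.
  by rewrite sum_sqr_cos_fourier_angle// mulf_neq0.
exists eta; split; last first.
  move=> k; have [_ _ H3 H4] := H k; case: ifPn => Nk; first by have [] := H3 Nk.
  by have [] := H4 (negbTE Nk).
apply: prod_XsubC_eq; rewrite -char_poly_eigenvalues ?circulant_hankel_sym//.
have chG : char_poly_mx H_N *m map_mx polyC G = map_mx polyC G *m char_poly_mx D.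
  by rewrite /char_poly_mx mulmxBr mulmxBl -!map_mxM HG scalar_mxC.
have -> : char_poly H_N = char_poly D.
  have /(congr1 determinant) := chG; rewrite !det_mulmx [RHS]mulrC.
  by apply: mulIf; rewrite det_map_mx polyC_eq0 -unitfE -unitmxE.
rewrite char_poly_trig ?diag_mx_is_trig// big_map big_enum/=.
by apply: eq_bigr => k _; rewrite !mxE eqxx mulr1n.
Qed.

(** After averaging over [k] and [- k] the summands agree exactly, except possibly at the
    frequencies [0] and [N./2]; each of these costs at most [2 * M]. *)
Lemma sum_circulant_hankel_eigenvalues (f : R -> R) (M : R) :
  (forall x, `|f x| <= M) ->
  `|\sum_(i < N) f ((eigenvalues (circulant_hankel N b))`_i) -
    \sum_(k < N) (f (dft_norm k) + f (- dft_norm k)) / 2| <= 4 * M.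
Proof.
move=> fM; have [eta [peta H]] := circulant_hankel_eigenvalues.
have M0 : 0 <= M := le_trans (normr_ge0 _) (fM 0).
have sE : size (eigenvalues (circulant_hankel N b)) = N.
  by rewrite size_eigenvalues// circulant_hankel_sym.
have -> : \sum_(i < N) f (eigenvalues (circulant_hankel N b))`_i =
    \sum_(k < N) f (eta k).
  transitivity (\sum_(x <- eigenvalues (circulant_hankel N b)) f x).
    by rewrite [RHS](big_nth 0) sE big_mkord.
  by rewrite (perm_big _ peta)/= big_map big_enum.
have -> : \sum_(k < N) f (eta k) = \sum_(k < N) (f (eta k) + f (eta (- k))) / 2.
  rewrite -mulr_suml big_split/= [X in _ + X](reindex_inj oppr_inj)/=.
  by under [X in _ + X]eq_bigr do rewrite opprK; field.
rewrite -sumrB; apply: (le_trans (ler_norm_sum _ _ _)).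
have -> : 4 * M = 2 * M + 2 * M by ring.
apply: (@le_trans _ _ (\sum_(k < N) (2 * M * (k == 0%N :> nat)%:R +
    2 * M * (k == N./2 :> nat)%:R))); last first.
  rewrite big_split/= -!mulr_sumr.
  by apply: lerD; rewrite ler_piMr ?mulr_ge0// sum_ord_eq_le1.
apply: ler_sum => k _.
have sym : (f (eta k) + f (eta (- k)) = f (dft_norm k) + f (- dft_norm k)) \/
    ((k == 0%N :> nat) || (k == N./2 :> nat)).
  have [/dvdnP[q qE]|Nk] := boolP (N %| k.*2)%N.
    right; have kN := ltn_ord k; case: q qE => [|[|q]] qE.
    - by rewrite (_ : k = 0%N :> nat)//; lia.
    - by rewrite (_ : k = N./2 :> nat) ?eqxx ?orbT//; lia.
    - by nia.
  left; have := H k; have := H (- k)%R; rewrite (negbTE Nk) dft_norm_oppr.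
  have kE := ord_opp_double (negbTE Nk).
  have kN := ltn_ord k.
  have kNN : (k.*2 == N) = false by apply/eqP => E; rewrite E dvdnn in Nk.
  have -> : (N %| ((- k)%R : 'I_N).*2)%N = false.
    apply/negbTE/dvdnP => -[q]; rewrite kE => qE; move/dvdnP: Nk; apply.
    by exists (2 - q)%N; nia.
  rewrite kE => -> ->; case: ifPn => k2; case: ifPn => k3 //; try by exfalso; lia.
  by rewrite addrC.
case: sym => [->|kk].
  by rewrite subrr normr0 addr_ge0// mulr_ge0 ?mulr_ge0.
apply: (@le_trans _ _ (2 * M)).
  have := fM (eta k); have := fM (eta (- k)); have := fM (dft_norm k).
  have := fM (- dft_norm k); rewrite !ler_norml.
  by move=> /andP[? ?] /andP[? ?] /andP[? ?] /andP[? ?]; apply/andP; split; lra.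
rewrite -mulrDr ler_peMr ?mulr_ge0// -natrD -[1]/(1%:R) ler_nat.
by case/orP: kk => ->; rewrite ?addn1 ?add1n.
Qed.

End circulant_hankel_spectrum.

(** * The Stein field of the periodogram *)

Section gaussian_profile.
Context {R : realType}.

Lemma mean_value (f g : R -> R) : (forall x : R, is_derive x 1 f (g x)) ->
  forall x t : R, exists2 z, `|z - x| <= `|t| & f (x + t) - f x = t * g z.
Proof.
move=> df x t.
have cf : continuous f.
  by move=> y; apply: differentiable_continuous; apply/derivable1_diffP; have [] := df y.
have [t0|t0|->] := ltgtP t 0; last first.
- by exists x; rewrite ?subrr ?normr0// addr0 subrr mul0r.
- have := @MVT R f g x (x + t); rewrite ltrDl => /(_ t0 (fun y _ => df y)) [].
    exact: continuous_subspaceT.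
  move=> z; rewrite in_itv/= => /andP[xz zt] ->; exists z.
    by rewrite !ger0_norm; lra.
  by rewrite addrAC subrr add0r mulrC.
- have := @MVT R f g (x + t) x; rewrite gtrDl => /(_ t0 (fun y _ => df y)) [].
    exact: continuous_subspaceT.
  move=> z; rewrite in_itv/= => /andP[xz zt] E; exists z.
    by rewrite !ler0_norm; lra.
  by rewrite -opprB E; ring.
Qed.

Lemma lipschitz_of_derive (f g : R -> R) (C : R) :
  (forall x : R, is_derive x 1 f (g x)) -> (forall x, `|g x| <= C) ->
  forall x t, `|f (x + t) - f x| <= C * `|t|.
Proof.
move=> df gC x t; have [z _ ->] := mean_value df x t.
by rewrite normrM mulrC ler_wpM2r.
Qed.

Lemma taylor1_of_derive2 (f g h : R -> R) (C : R) :
  (forall x : R, is_derive x 1 f (g x)) -> (forall x : R, is_derive x 1 g (h x)) ->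
  (forall x, `|h x| <= C) ->
  forall x t, `|f (x + t) - f x - t * g x| <= C * t ^+ 2.
Proof.
move=> df dg hC x t.
have [z zt ->] := mean_value df x t.
rewrite -mulrBr normrM -[z](subrK x) [z - x + x]addrC.
have C0 : 0 <= C := le_trans (normr_ge0 _) (hC 0).
rewrite -[t ^+ 2]real_normK ?num_real// expr2 mulrCA ler_wpM2l//.
by apply: (le_trans (lipschitz_of_derive dg hC _ _)); rewrite ler_wpM2l.
Qed.

Lemma expRN_le1 (y : R) : 0 <= y -> expR (- y) <= 1.
Proof. by move=> y0; rewrite -expR0 ler_expR oppr_le0. Qed.

Lemma mul_expRN_le1 (y : R) : 0 <= y -> y * expR (- y) <= 1.
Proof.
move=> y0; rewrite expRN ler_pdivrMr ?expR_gt0// mul1r.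
by apply: le_trans (expR_ge1Dx y); rewrite lerDr.
Qed.

Lemma mul_sqr_expRN_le2 (y : R) : 0 <= y -> y ^+ 2 * expR (- y) <= 2.
Proof.
move=> y0; rewrite expRN ler_pdivrMr ?expR_gt0//.
have : 1 + y ^+ 2 / 2 <= expR y := expR_ge1Dxn 1 y0.
by lra.
Qed.

(** Seen as functions of one entry, the summands of the Laplace average, of the Stein field and of
    its derivative are [gauss0], [gauss1], [gauss2] of an affine function of that entry, times a
    factor free of it. [gauss2] and [gauss3] are the first two derivatives of [gauss1]. *)
Definition gauss0 (s x : R) := expR (- (s * x ^+ 2)).
Definition gauss1 (s x : R) := x * gauss0 s x.
Definition gauss2 (s x : R) := (1 - 2 * s * x ^+ 2) * gauss0 s x.
Definition gauss3 (s x : R) := (4 * s ^+ 2 * x ^+ 3 - 6 * s * x) * gauss0 s x.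

Lemma is_derive_gauss0 (s x : R) : is_derive x 1 (gauss0 s) (- (2 * s * gauss1 s x)).
Proof.
have dX : is_derive x 1 (fun y : R => - (s * y ^+ 2)) (- (2 * s * x)).
  by apply: is_derive_eq; rewrite /GRing.scale/=; ring.
apply: (is_derive_eq (@is_derive1_comp R expR _ x _ _ (is_derive_expR (- (s * x ^+ 2))) dX)).
by rewrite /gauss1 /gauss0; ring.
Qed.

Lemma is_derive_gauss1 (s x : R) : is_derive x 1 (gauss1 s) (gauss2 s x).
Proof.
have d0 := is_derive_gauss0 s x.
by apply: is_derive_eq; rewrite /GRing.scale/= /gauss2 /gauss1; ring.
Qed.

Lemma is_derive_gauss2 (s x : R) : is_derive x 1 (gauss2 s) (gauss3 s x).
Proof.
have d0 := is_derive_gauss0 s x.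
by apply: is_derive_eq; rewrite /GRing.scale/= /gauss3 /gauss1; ring.
Qed.

Section bounds.
Variables (S s x : R) (s0 : 0 <= s) (sS : s <= S).

Let y := s * x ^+ 2.
Let y0 : 0 <= y. Proof. by rewrite mulr_ge0// sqr_ge0. Qed.
Let S0 : 0 <= S. Proof. exact: le_trans sS. Qed.

Lemma gauss0_ge0 : 0 <= gauss0 s x. Proof. exact: expR_ge0. Qed.

Lemma gauss0_le1 : gauss0 s x <= 1. Proof. exact: expRN_le1. Qed.

Lemma norm_derive_gauss0 : `|- (2 * s * gauss1 s x)| <= 10 * S + 30.
Proof.
have : `|x| <= 1 + x ^+ 2.
  by rewrite ler_norml; apply/andP; split; nra.
move=> xx; rewrite normrN !normrM (ger0_norm gauss0_ge0) (ger0_norm s0).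
rewrite (ger0_norm (ler0n _ _)).
have := mul_expRN_le1 y0; have := gauss0_ge0; have := gauss0_le1.
rewrite -/(gauss0 s x) /y; move: (gauss0 s x) => g g1 g0 yg.
apply: (@le_trans _ _ (2 * (s * g + s * x ^+ 2 * g))); last first.
  have : s * g <= S by apply: le_trans sS; rewrite ler_piMr.
  by have := S0; lra.
rewrite -mulrA ler_wpM2l//.
rewrite (_ : _ + _ = s * ((1 + x ^+ 2) * g)); last by ring.
by rewrite ler_wpM2l// ler_wpM2r.
Qed.

Lemma norm_gauss2 : `|gauss2 s x| <= 3.
Proof.
have := mul_expRN_le1 y0; have := gauss0_ge0; have := gauss0_le1.
rewrite /gauss2 -/(gauss0 s x) /y; move: (gauss0 s x) => g g1 g0 yg.
have : 0 <= s * x ^+ 2 * g by rewrite mulr_ge0.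
by rewrite ler_norml; lra.
Qed.

(** Odd powers of [x] are first bounded by even ones, so that only powers of [y = s x^2] and of [s]
    remain. With [g = gauss0 s x], the terms [4 s y g], [4 y^2 g], [6 s g], [6 y g] are at most
    [4 S], [8], [6 S], [6]; the constant [10 * S + 30] is a roomy common bound for all the
    profiles. *)
Lemma norm_gauss3 : `|gauss3 s x| <= 10 * S + 30.
Proof.
have x1 : `|x| <= 1 + x ^+ 2 by rewrite ler_norml; apply/andP; split; nra.
have x3 : `|x| ^+ 3 <= x ^+ 2 + x ^+ 4.
  rewrite exprS -normrX (ger0_norm (sqr_ge0 _)).
  rewrite (_ : x ^+ 2 + x ^+ 4 = (1 + x ^+ 2) * x ^+ 2); last by ring.
  by rewrite ler_wpM2r// sqr_ge0.
have := mul_expRN_le1 y0; have := mul_sqr_expRN_le2 y0.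
have := gauss0_ge0; have := gauss0_le1.
rewrite /gauss3 -/(gauss0 s x) /y; move: (gauss0 s x) => g g1 g0 yyg yg.
rewrite normrM (ger0_norm g0).
have sg : s * g <= S by apply: le_trans sS; rewrite ler_piMr.
have syg : s * (s * x ^+ 2 * g) <= S.
  by apply: le_trans sS; rewrite ler_piMr.
apply: (@le_trans _ _ ((4 * s ^+ 2 * (x ^+ 2 + x ^+ 4) + 6 * s * (1 + x ^+ 2)) * g)).
  rewrite ler_wpM2r//; apply: (le_trans (ler_normB _ _)).
  apply: lerD; rewrite normrM.
    rewrite ger0_norm ?mulr_ge0 ?sqr_ge0// ler_wpM2l ?mulr_ge0 ?sqr_ge0//.
    by rewrite normrX.
  by rewrite ger0_norm ?mulr_ge0// ler_wpM2l ?mulr_ge0.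
by have := S0; lra.
Qed.

End bounds.

Lemma gauss0_lipschitz (S s x t : R) : 0 <= s <= S ->
  `|gauss0 s (x + t) - gauss0 s x| <= (10 * S + 30) * `|t|.
Proof.
move=> /andP[s0 sS]; apply: (lipschitz_of_derive (@is_derive_gauss0 s)) => z.
exact: norm_derive_gauss0.
Qed.

Lemma gauss2_lipschitz (S s x t : R) : 0 <= s <= S ->
  `|gauss2 s (x + t) - gauss2 s x| <= (10 * S + 30) * `|t|.
Proof.
move=> /andP[s0 sS]; apply: (lipschitz_of_derive (@is_derive_gauss2 s)) => z.
exact: norm_gauss3.
Qed.

Lemma gauss1_taylor (S s x t : R) : 0 <= s <= S ->
  `|gauss1 s (x + t) - gauss1 s x - t * gauss2 s x| <= (10 * S + 30) * t ^+ 2.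
Proof.
move=> /andP[s0 sS].
apply: (taylor1_of_derive2 (@is_derive_gauss1 s) (@is_derive_gauss2 s)) => z.
exact: norm_gauss3.
Qed.

End gaussian_profile.

(** * The periodogram, its Stein field, and the removal of one entry *)

Section periodogram.
Context {R : realType} (N : nat).
Implicit Types (b : nat -> R) (s S : R) (j k : nat).

Local Notation ang := (@fourier_angle R N).

Definition rsqrtN : R := (Num.sqrt N%:R)^-1.
Local Notation th := rsqrtN.

Definition ndft_cos b k := th * \sum_(j < N) b j * cos (ang (j * k)).
Definition ndft_sin b k := th * \sum_(j < N) b j * sin (ang (j * k)).
Definition periodogram b k := ndft_cos b k ^+ 2 + ndft_sin b k ^+ 2.

(** The Fourier coefficient of frequency [k] in the frame rotated by the angle of entry [j]:
    [aligned] is affine in [b j] with slope [rsqrtN], and [orthogonal_part] does not depend on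
    [b j]. *)
Definition aligned b j k :=
  cos (ang (j * k)) * ndft_cos b k + sin (ang (j * k)) * ndft_sin b k.
Definition orthogonal_part b j k :=
  cos (ang (j * k)) * ndft_sin b k - sin (ang (j * k)) * ndft_cos b k.

Definition periodogram_laplace s b :=
  N%:R^-1 * \sum_(k < N) expR (- (s * periodogram b k)).

(* [stein_field] is the vector field [V] of the Stein identity, with
   [sum_j b_j V_j = sum_k Y_k exp (- s Y_k)], and [stein_field'] is the partial
   derivative of [V_j] with respect to [b_j]. *)
Definition stein_field s b j :=
  th * \sum_(k < N) aligned b j k * expR (- (s * periodogram b k)).
Definition stein_field' s b j :=
  th ^+ 2 * \sum_(k < N) (1 - 2 * s * aligned b j k ^+ 2) *
    expR (- (s * periodogram b k)).

Definition exp_stein s b :=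
  N%:R^-1 * \sum_(k < N) (1 - (1 + s) * periodogram b k) *
    expR (- (s * periodogram b k)).

Definition drop_entry j b : nat -> R := fun i => if i == j then 0 else b i.

Hypothesis N0 : (0 < N)%N.

Lemma rsqrtN_gt0 : 0 < th.
Proof. by rewrite invr_gt0 sqrtr_gt0 ltr0n. Qed.

Lemma rsqrtN_sqr : th ^+ 2 = N%:R^-1.
Proof. by rewrite exprVn sqr_sqrtr. Qed.

Lemma rsqrtN_le1 : th <= 1.
Proof.
rewrite invf_le1 ?sqrtr_gt0 ?ltr0n//.
by rewrite -[leLHS]sqrtr1 ler_sqrt// ler1n.
Qed.

Lemma periodogram_ge0 b k : 0 <= periodogram b k.
Proof. by rewrite addr_ge0// sqr_ge0. Qed.

Lemma sum_drop_entry j b (F : nat -> R) : (j < N)%N ->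
  \sum_(i < N) b i * F i = b j * F j + \sum_(i < N) drop_entry j b i * F i.
Proof.
move=> jN; rewrite (bigD1 (Ordinal jN))//= [in RHS](bigD1 (Ordinal jN))//=.
rewrite /drop_entry eqxx mul0r add0r; congr (_ + _); apply: eq_bigr => i ij.
by rewrite ifN.
Qed.

Lemma periodogram_split b j k :
  periodogram b k = aligned b j k ^+ 2 + orthogonal_part b j k ^+ 2.
Proof.
rewrite /periodogram /aligned /orthogonal_part.
have := cos2Dsin2 (ang (j * k)).
move: (cos _) (sin _) (ndft_cos b k) (ndft_sin b k) => c d x y cd.
transitivity ((c ^+ 2 + d ^+ 2) * (x ^+ 2 + y ^+ 2)); last by ring.
by rewrite cd mul1r.
Qed.

Lemma aligned_drop b j k : (j < N)%N ->
  aligned b j k = aligned (drop_entry j b) j k + th * b j.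
Proof.
move=> jN; rewrite /aligned /ndft_cos /ndft_sin.
rewrite (sum_drop_entry b (fun i => cos (ang (i * k))) jN).
rewrite (sum_drop_entry b (fun i => sin (ang (i * k))) jN).
have := cos2Dsin2 (ang (j * k)).
move: (cos _) (sin _) => c d cd.
rewrite -[in RHS](mulr1 (b j)) -cd; ring.
Qed.

Lemma orthogonal_part_drop b j k : (j < N)%N ->
  orthogonal_part b j k = orthogonal_part (drop_entry j b) j k.
Proof.
move=> jN; rewrite /orthogonal_part /ndft_cos /ndft_sin.
rewrite (sum_drop_entry b (fun i => cos (ang (i * k))) jN).
rewrite (sum_drop_entry b (fun i => sin (ang (i * k))) jN).
ring.
Qed.

Lemma sum_periodogram b : \sum_(k < N) periodogram b k = \sum_(j < N) b j ^+ 2.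
Proof.
transitivity (th ^+ 2 * (N%:R * \sum_(j < N) b j ^+ 2)); last first.
  by rewrite rsqrtN_sqr mulKf// pnatr_eq0 -lt0n.
rewrite -(@parseval _ _ (fun j : 'I_N => b j)) mulr_sumr; apply: eq_bigr => k _.
by rewrite /periodogram /ndft_cos /ndft_sin; ring.
Qed.

(** Over a full period the squared cosine and the squared sine average to one half and the mixed
    product to [0], provided that the doubled frequency is not trivial. *)
Lemma sum_aligned_sqr b k : (N %| k.*2)%N = false ->
  \sum_(j < N) aligned b j k ^+ 2 = N%:R / 2 * periodogram b k.
Proof.
move=> /negbT Nk.
have c2 := sum_sqr_cos_fourier_angle 0 N0 Nk.
(* Sines are written as cosines of phase [- pi / 2], so that the cosine sums apply to them. *)
have s2 := sum_sqr_cos_fourier_angle (- (pi / 2)) N0 Nk.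
have cs := sum_cos_fourier_angle (- (pi / 2)) N0 Nk.
transitivity (\sum_(j < N) (ndft_cos b k ^+ 2 * cos (ang (j * k) + 0) ^+ 2 +
    ndft_sin b k ^+ 2 * cos (ang (j * k) - pi / 2) ^+ 2 +
    (ndft_cos b k * ndft_sin b k) * cos (ang (j * k.*2) - pi / 2))).
  apply: eq_bigr => j _; rewrite addr0 !cosBpihalf /aligned.
  by rewrite -muln2 mulnA muln2 -addnn fourier_angleD sinD; ring.
by rewrite !big_split/= -!mulr_sumr c2 s2 cs /periodogram; ring.
Qed.

(** For [2 k] not divisible by [N], [sum_aligned_sqr] makes the summands equal. For the at most two
    other frequencies the difference is [s (Y - 2 a) exp (- s Y)] with [0 <= a <= Y], which is at
    most [s Y exp (- s Y) <= 1] in absolute value. *)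
Lemma stein_identity s b : 0 <= s ->
  `|\sum_(j < N) (stein_field' s b j - b j * stein_field s b j) -
    N%:R * exp_stein s b| <= 2.
Proof.
move=> s0.
have N0R : N%:R != 0 :> R by rewrite pnatr_eq0 -lt0n.
pose e k := expR (- (s * periodogram b k)).
have -> : \sum_(j < N) (stein_field' s b j - b j * stein_field s b j) =
    \sum_(k < N) (1 - 2 * s * (th ^+ 2 * \sum_(j < N) aligned b j k ^+ 2) -
      periodogram b k) * e k.
  rewrite sumrB.
  have -> : \sum_(j < N) b j * stein_field s b j = \sum_(k < N) periodogram b k * e k.
    under eq_bigr do rewrite /stein_field mulrCA mulr_sumr.
    rewrite -mulr_sumr exchange_big/= mulr_sumr; apply: eq_bigr => k _.
    under eq_bigr do rewrite mulrA.
    rewrite -mulr_suml mulrA; congr (_ * _).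
    have -> : periodogram b k = th * ((\sum_(j < N) b j * cos (ang (j * k))) *
        ndft_cos b k + (\sum_(j < N) b j * sin (ang (j * k))) * ndft_sin b k).
      by rewrite /periodogram /ndft_cos /ndft_sin; ring.
    congr (_ * _); rewrite !mulr_suml -big_split/=; apply: eq_bigr => j _.
    by rewrite /aligned; ring.
  have -> : \sum_(j < N) stein_field' s b j =
      \sum_(k < N) (1 - 2 * s * (th ^+ 2 * \sum_(j < N) aligned b j k ^+ 2)) * e k.
    rewrite -mulr_sumr exchange_big/= mulr_sumr; apply: eq_bigr => k _.
    rewrite -mulr_suml mulrA; congr (_ * _).
    rewrite sumrB sumr_const card_ord -mulr_sumr mulrBr rsqrtN_sqr.
    by rewrite -[1 *+ N]/(N%:R) mulVf//; congr (_ - _); ring.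
  by rewrite -sumrB; apply: eq_bigr => k _; rewrite -mulrBl.
rewrite /exp_stein mulVKf// -sumrB.
apply: (le_trans (ler_norm_sum _ _ _)); apply: le_trans (sum_self_dual_le2 N0).
apply: ler_sum => k _; have [Nk|/negbTE Nk] := boolP (N %| k.*2)%N; last first.
  rewrite sum_aligned_sqr// rsqrtN_sqr [X in X <= _](_ : _ = 0)//.
  apply/eqP; rewrite normr_eq0 subr_eq0; apply/eqP; congr (_ * _).
  by field.
have e0 : 0 <= s * periodogram b k by rewrite mulr_ge0// periodogram_ge0.
rewrite -/(e k) -mulrBl.
have A0 : 0 <= th ^+ 2 * \sum_(j < N) aligned b j k ^+ 2.
  by rewrite mulr_ge0 ?sqr_ge0// sumr_ge0// => j _; rewrite sqr_ge0.
have A1 : th ^+ 2 * \sum_(j < N) aligned b j k ^+ 2 <= periodogram b k.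
  rewrite rsqrtN_sqr mulrC ler_pdivrMr ?ltr0n// mulr_natr.
  rewrite -[leRHS](_ : \sum_(j < N) periodogram b k = _); last first.
    by rewrite sumr_const card_ord.
  apply: ler_sum => j _; rewrite (periodogram_split b j) lerDl sqr_ge0//.
rewrite (_ : _ - _ - _ - _ = s * (periodogram b k -
   2 * (th ^+ 2 * \sum_(j < N) aligned b j k ^+ 2))); last by ring.
rewrite normrM (ger0_norm (expR_ge0 _)).
apply: le_trans (mul_expRN_le1 e0); rewrite ler_wpM2r ?expR_ge0//.
by rewrite normrM (ger0_norm s0) ler_wpM2l// ler_norml; apply/andP; split; lra.
Qed.

(** The field is the Fourier transform of [b], multiplied by factors in [[0, 1]] and transformed
    back, hence a contraction. Concretely, the sum of the [V_j ^+ 2] is a pairing of transforms, at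
    most half the energy of [b] plus half that of [V] by Parseval, and the latter is absorbed. *)
Lemma sum_stein_field_sqr s b : 0 <= s ->
  \sum_(j < N) stein_field s b j ^+ 2 <= \sum_(j < N) b j ^+ 2.
Proof.
move=> s0; pose v := stein_field s b.
pose e k := expR (- (s * periodogram b k)).
have e1 k : 0 <= e k <= 1.
  by rewrite expR_ge0 expRN_le1// mulr_ge0// periodogram_ge0.
have E : \sum_(j < N) v j ^+ 2 = \sum_(k < N) (ndft_cos b k * e k * ndft_cos v k +
    ndft_sin b k * e k * ndft_sin v k).
  under eq_bigr do rewrite expr2 {2}/v /stein_field mulrCA mulr_sumr.
  rewrite -mulr_sumr exchange_big/= mulr_sumr; apply: eq_bigr => k _.
  rewrite [ndft_cos v k]/ndft_cos [ndft_sin v k]/ndft_sin !mulr_sumr -big_split/=; apply: eq_bigr => j _.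
  by rewrite /aligned /e; ring.
have : \sum_(j < N) v j ^+ 2 <= \sum_(k < N) (periodogram b k + periodogram v k) / 2.
  rewrite E; apply: ler_sum => k _; have /andP[e0 e1k] := e1 k.
  rewrite /periodogram; move: (e k) (ndft_cos b k) (ndft_sin b k) e0 e1k.
  move: (ndft_cos v k) (ndft_sin v k) => x y t p q t0 t1.
  have tp : (p * t) ^+ 2 <= p ^+ 2.
    by rewrite exprMn ler_piMr ?sqr_ge0// expr_le1.
  have tq : (q * t) ^+ 2 <= q ^+ 2.
    by rewrite exprMn ler_piMr ?sqr_ge0// expr_le1.
  have := sqr_ge0 (p * t - x); have := sqr_ge0 (q * t - y).
  by move: (p * t) (q * t) tp tq => p' q' ? ? ? ?; lra.
by rewrite -mulr_suml big_split/= !sum_periodogram; lra.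
Qed.

Lemma periodogram_laplace_ge0 s b : 0 <= periodogram_laplace s b.
Proof. by rewrite mulr_ge0 ?invr_ge0// sumr_ge0// => k _; exact: expR_ge0. Qed.

Lemma periodogram_laplace_le1 s b : 0 <= s -> periodogram_laplace s b <= 1.
Proof.
move=> s0; rewrite /periodogram_laplace mulrC ler_pdivrMr ?ltr0n// mul1r.
rewrite -[leRHS](_ : \sum_(k < N) 1 = _); last by rewrite sumr_const card_ord.
by apply: ler_sum => k _; rewrite expRN_le1// mulr_ge0// periodogram_ge0.
Qed.

Section drop.
Variables (S s : R) (b : nat -> R) (j : nat).
Hypotheses (sS : 0 <= s <= S) (jN : (j < N)%N).

Local Notation b' := (drop_entry j b).
Local Notation C := (10 * S + 30).

Let expR_split k : expR (- (s * periodogram b k)) =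
  gauss0 s (aligned b' j k + th * b j) * gauss0 s (orthogonal_part b' j k).
Proof.
rewrite (periodogram_split b j) aligned_drop// orthogonal_part_drop// -expRD.
by congr expR; ring.
Qed.

Let expR_split' k : expR (- (s * periodogram b' k)) =
  gauss0 s (aligned b' j k) * gauss0 s (orthogonal_part b' j k).
Proof. by rewrite (periodogram_split b' j) -expRD; congr expR; ring. Qed.

Let sum_bound (F : 'I_N -> R) (A : R) : (forall k : 'I_N, `|F k| <= A) ->
  `|\sum_(k < N) F k| <= N%:R * A.
Proof.
move=> FA; apply: (le_trans (ler_norm_sum _ _ _)).
rewrite -[leRHS](_ : \sum_(k < N) A = _); first exact: ler_sum.
by rewrite sumr_const card_ord mulr_natl.
Qed.

Let norm_mul_gauss0 (x y : R) : `|x * gauss0 s y| <= `|x|.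
Proof.
have /andP[s0 _] := sS.
by rewrite normrM (ger0_norm (gauss0_ge0 _ _)) ler_piMr// gauss0_le1.
Qed.

Let N0R : N%:R != 0 :> R. Proof. by rewrite pnatr_eq0 -lt0n. Qed.

Lemma periodogram_laplace_drop :
  `|periodogram_laplace s b - periodogram_laplace s b'| <= C * (th * `|b j|).
Proof.
rewrite /periodogram_laplace -mulrBr normrM ger0_norm ?invr_ge0//.
rewrite mulrC ler_pdivrMr ?ltr0n// [leRHS]mulrC -sumrB.
apply: sum_bound => k; rewrite expR_split expR_split' -mulrBl.
apply: (le_trans (norm_mul_gauss0 _ _)).
apply: (le_trans (gauss0_lipschitz _ _ sS)).
by rewrite normrM gtr0_norm ?rsqrtN_gt0.
Qed.

(** First-order Taylor expansion in the increment [th * b j] of the aligned part: [N] remainders of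
    size [(th * b j) ^+ 2] with the prefactor [th], where [N * th ^+ 2 = 1]. *)
Lemma stein_field_drop :
  `|stein_field s b j - stein_field s b' j - b j * stein_field' s b' j| <=
  C * (th * b j ^+ 2).
Proof.
have -> : stein_field s b j - stein_field s b' j - b j * stein_field' s b' j =
    th * \sum_(k < N) (gauss1 s (aligned b' j k + th * b j) - gauss1 s (aligned b' j k) -
      th * b j * gauss2 s (aligned b' j k)) * gauss0 s (orthogonal_part b' j k).
  rewrite /stein_field /stein_field'.
  rewrite (_ : b j * _ = th * \sum_(k < N) th * b j *
    ((1 - 2 * s * aligned b' j k ^+ 2) * expR (- (s * periodogram b' k)))); last first.
    by rewrite -mulr_sumr; ring.
  rewrite -!mulrBr -!sumrB; congr (_ * _); apply: eq_bigr => k _.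
  by rewrite expR_split expR_split' (aligned_drop b k jN) /gauss1 /gauss2; ring.
rewrite normrM (gtr0_norm rsqrtN_gt0).
apply: (@le_trans _ _ (th * (N%:R * (C * (th * b j) ^+ 2)))).
  rewrite ler_wpM2l ?(ltW rsqrtN_gt0)//; apply: sum_bound => k.
  by apply: (le_trans (norm_mul_gauss0 _ _)); exact: gauss1_taylor.
rewrite exprMn rsqrtN_sqr le_eqVlt; apply/orP; left; apply/eqP.
by field.
Qed.

Lemma stein_field'_drop :
  `|stein_field' s b j - stein_field' s b' j| <= C * (th * `|b j|).
Proof.
rewrite /stein_field' -mulrBr -sumrB normrM rsqrtN_sqr ger0_norm ?invr_ge0//.
rewrite mulrC ler_pdivrMr ?ltr0n// [leRHS]mulrC.
apply: sum_bound => k; rewrite expR_split expR_split' (aligned_drop b k jN).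
rewrite (_ : _ - _ = (gauss2 s (aligned b' j k + th * b j) -
  gauss2 s (aligned b' j k)) * gauss0 s (orthogonal_part b' j k)); last first.
  by rewrite /gauss2; ring.
apply: (le_trans (norm_mul_gauss0 _ _)).
apply: (le_trans (gauss2_lipschitz _ _ sS)).
by rewrite normrM gtr0_norm ?rsqrtN_gt0.
Qed.

Lemma stein_field'_bound : `|stein_field' s b' j| <= 3.
Proof.
have /andP[s0 _] := sS.
rewrite /stein_field' normrM rsqrtN_sqr ger0_norm ?invr_ge0//.
rewrite mulrC ler_pdivrMr ?ltr0n// [leRHS]mulrC.
apply: sum_bound => k; rewrite expR_split' mulrA.
apply: (le_trans (norm_mul_gauss0 _ _)).
by rewrite -/(gauss2 s (aligned b' j k)); exact: norm_gauss2.
Qed.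

End drop.
End periodogram.

(** * Moments and independence *)

Section product_expectation.
Context d d1 d2 (T : measurableType d) (T1 : measurableType d1)
  (T2 : measurableType d2) (R : realType) (P : probability T R).

(** The joint law agrees with the product of the laws on rectangles, hence everywhere, and Fubini
    applies. The target of [Y] is arbitrary, so that [Y] can be the identity onto the same space
    with a smaller sigma-algebra. *)
Lemma integral_mul_of_independent (X : T -> T1) (Y : T -> T2)
    (f : T1 -> R) (g : T2 -> R) :
  measurable_fun setT X -> measurable_fun setT Y ->
  (forall A B, measurable A -> measurable B ->
    P (X @^-1` A `&` Y @^-1` B) = (P (X @^-1` A) * P (Y @^-1` B))%E) ->
  measurable_fun setT f -> measurable_fun setT g ->
  P.-integrable setT (EFin \o (f \o X)) -> P.-integrable setT (EFin \o (g \o Y)) ->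
  P.-integrable setT (fun w => (f (X w) * g (Y w))%:E) ->
  (\int[P]_w (f (X w) * g (Y w)) = (\int[P]_w f (X w)) * (\int[P]_w g (Y w)))%R.
Proof.
move=> mX mY XY mf mg If Ig Ifg.
have mZ : measurable_fun setT (fun w => (X w, Y w)) by exact: measurable_fun_pair.
pose X' : {mfun T >-> T1} := mfun_Sub (mem_set mX).
pose Y' : {mfun T >-> T2} := mfun_Sub (mem_set mY).
pose Z' : {mfun T >-> (T1 * T2)%type} := mfun_Sub (mem_set mZ).
pose m1 := distribution P X'; pose m2 := distribution P Y'.
pose h := fun z : T1 * T2 => (f z.1 * g z.2)%:E.
have mh : measurable_fun setT h.
  apply/measurable_EFinP; apply: measurable_funM; exact: measurableT_comp.
have prodE A : measurable A -> (m1 \x m2)%E A = distribution P Z' A.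
  by move=> mA; exact: (@product_measure_unique _ _ _ _ _ m1 m2).
have Ih : (m1 \x m2)%E.-integrable setT h.
  have : (distribution P Z').-integrable setT h.
    exact: integrable_pushforward.
  move=> /integrableP[_ hoo]; apply/integrableP; split => //.
  rewrite (@eq_measure_integral _ _ _ _ (distribution P Z'))//.
  by move=> A mA _; exact: prodE.
rewrite /Rintegral.
have -> : (\int[P]_w (f (X w) * g (Y w))%:E = \int[m1 \x m2]_z h z)%E.
  rewrite (@eq_measure_integral _ _ _ _ (distribution P Z')); last first.
    by move=> A mA _; exact: prodE.
  by rewrite integral_distribution.
have If1 : m1.-integrable setT (EFin \o f).
  by apply: integrable_pushforward => //; exact/measurable_EFinP.
have Ig2 : m2.-integrable setT (EFin \o g).
  by apply: integrable_pushforward => //; exact/measurable_EFinP.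
rewrite -integral12_prod_meas1// /fubini_F/=.
have fg x : (\int[m2]_y h (x, y) = (f x)%:E * \int[P]_w (g (Y w))%:E)%E.
  rewrite /h /=; under eq_integral do rewrite EFinM.
  rewrite integralZl//.
  by congr (_ * _)%E; rewrite integral_distribution//; exact/measurable_EFinP.
under eq_integral do rewrite fg.
have gfin : (\int[P]_w (g (Y w))%:E)%E \is a fin_num.
  exact: (integrable_fin_num measurableT Ig).
rewrite -(fineK gfin) integralZr//.
rewrite integral_distribution//; last exact/measurable_EFinP.
have ffin : (\int[P]_w (f (X w))%:E)%E \is a fin_num.
  exact: (integrable_fin_num measurableT If).
by rewrite fineM.
Qed.

End product_expectation.

(** * Random variables with finite moments of every order *)

Section all_moments.
Context d (T : measurableType d) (R : realType) (P : probability T R).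
Implicit Types f g : T -> R.

(** Unlike plain integrability, this class is closed under products, so integrability can be checked
    by following the shape of an expression. *)
Definition all_moments f := measurable_fun setT f /\
  forall p : nat, P.-integrable setT (fun w => (`|f w| ^+ p)%:E).

Lemma all_moments_le f g : measurable_fun setT f ->
  (forall w, `|f w| <= `|g w|) -> all_moments g -> all_moments f.
Proof.
move=> mf fg [mg Ig]; split => // p; apply: le_integrable (Ig p) => //.
  apply/measurable_EFinP; apply: measurable_funX.
  exact: measurableT_comp.
move=> w _ /=; rewrite lee_fin !normrX !normr_id.
by rewrite lerXn2r ?nnegrE.
Qed.

Lemma all_moments_cst (c : R) : all_moments (fun=> c).
Proof.
split; first exact: measurable_cst.
by move=> p; exact: finite_measure_integrable_cst.
Qed.

Lemma all_momentsM f g : all_moments f -> all_moments g ->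
  all_moments (fun w => f w * g w).
Proof.
move=> [mf If] [mg Ig]; have mfg : measurable_fun setT (fun w => f w * g w).
  exact: measurable_funM.
split => // p.
have H := integrableD measurableT (If (p + p)%N) (Ig (p + p)%N).
apply: le_integrable H => //.
  apply/measurable_EFinP; apply: measurable_funX.
  exact: measurableT_comp.
move=> w _ /=; rewrite lee_fin [leRHS]ger0_norm ?addr_ge0 ?exprn_ge0//.
rewrite ger0_norm ?exprn_ge0// normrM exprMn !exprD -!expr2.
move: (_ ^+ p) (_ ^+ p) => x y.
have := sqr_ge0 (x - y); have := sqr_ge0 x; have := sqr_ge0 y.
nra.
Qed.

Lemma all_momentsD f g : all_moments f -> all_moments g ->
  all_moments (fun w => f w + g w).
Proof.
move=> [mf If] [mg Ig]; have mfg : measurable_fun setT (fun w => f w + g w).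
  exact: measurable_funD.
split => // p.
have H := integrableZl measurableT (2 ^+ p)%R (integrableD measurableT (If p) (Ig p)).
apply: le_integrable H => //.
  apply/measurable_EFinP; apply: measurable_funX.
  exact: measurableT_comp.
move=> w _ /=; rewrite lee_fin [leRHS]ger0_norm ?mulr_ge0 ?addr_ge0 ?exprn_ge0//.
rewrite ger0_norm ?exprn_ge0//.
apply: (@le_trans _ _ ((2 * Num.max `|f w| `|g w|) ^+ p)).
  rewrite lerXn2r ?nnegrE ?mulr_ge0 ?le_max ?normr_ge0//.
  apply: (le_trans (ler_normD _ _)).
  by rewrite mulr_natl mulr2n lerD// le_max lexx ?orbT.
rewrite exprMn ler_wpM2l ?exprn_ge0//.
by case: (leP `|f w| `|g w|) => _; rewrite ?lerDl ?lerDr exprn_ge0.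
Qed.

Lemma all_momentsN f : all_moments f -> all_moments (fun w => - f w).
Proof.
move=> af; apply: all_moments_le (af); last by move=> w; rewrite normrN.
by apply: measurableT_comp => //; case: af.
Qed.

Lemma all_momentsB f g : all_moments f -> all_moments g ->
  all_moments (fun w => f w - g w).
Proof. by move=> af ag; apply: all_momentsD => //; exact: all_momentsN. Qed.

Lemma all_momentsX f p : all_moments f -> all_moments (fun w => f w ^+ p).
Proof.
move=> af; elim: p => [|p IHp]; first exact: all_moments_cst.
by under eq_fun do rewrite exprS; exact: all_momentsM.
Qed.

Lemma all_moments_norm f : all_moments f -> all_moments (fun w => `|f w|).
Proof.
move=> af; apply: all_moments_le (af); last by move=> w; rewrite normr_id.
by apply: measurableT_comp => //; case: af.
Qed.

Lemma all_moments_sum (I : Type) (r : seq I) (F : I -> T -> R) :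
  (forall i, all_moments (F i)) -> all_moments (fun w => \sum_(i <- r) F i w).
Proof.
move=> aF; elim: r => [|i r IHr].
  by under eq_fun do rewrite big_nil; exact: all_moments_cst.
by under eq_fun do rewrite big_cons; exact: all_momentsD.
Qed.

Lemma all_moments_integrable f : all_moments f -> P.-integrable setT (EFin \o f).
Proof.
move=> [mf If]; apply: le_integrable (If 1%N) => //; first exact/measurable_EFinP.
by move=> w _ /=; rewrite lee_fin expr1 normr_id.
Qed.

Lemma all_moments_of_expr f : measurable_fun setT f ->
  (forall k, P.-integrable setT (fun w => (f w ^+ k)%:E)) -> all_moments f.
Proof.
move=> mf If; split => // p; apply: le_integrable (If p) => //.
  apply/measurable_EFinP; apply: measurable_funX.
  exact: measurableT_comp.
by move=> w _ /=; rewrite lee_fin !normrX normr_id.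
Qed.

Local Notation E f := (\int[P]_w f w).

Lemma meanD f g : all_moments f -> all_moments g ->
  E (fun w => f w + g w) = E f + E g.
Proof. by move=> af ag; rewrite RintegralD//; exact: all_moments_integrable. Qed.

Lemma meanB f g : all_moments f -> all_moments g ->
  E (fun w => f w - g w) = E f - E g.
Proof. by move=> af ag; rewrite RintegralB//; exact: all_moments_integrable. Qed.

Lemma meanZ c f : all_moments f -> E (fun w => c * f w) = c * E f.
Proof. by move=> af; rewrite RintegralZl//; exact: all_moments_integrable. Qed.

Lemma mean_cst c : E (fun=> c) = c.
Proof.
rewrite /Rintegral integral_cst// [X in (_ * X)%E](_ : _ = 1%E) ?mule1//.
exact: probability_setT.
Qed.

Lemma mean_sum (I : Type) (r : seq I) (F : I -> T -> R) :
  (forall i, all_moments (F i)) ->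
  E (fun w => \sum_(i <- r) F i w) = \sum_(i <- r) E (F i).
Proof.
move=> aF; elim: r => [|i r IHr].
  by rewrite big_nil; under eq_fun do rewrite big_nil; rewrite mean_cst.
rewrite big_cons; under eq_fun do rewrite big_cons.
by rewrite meanD ?IHr//; exact: all_moments_sum.
Qed.

Lemma mean_le f g : all_moments f -> all_moments g -> (forall w, f w <= g w) ->
  E f <= E g.
Proof. by move=> af ag fg; apply: le_Rintegral => //; exact: all_moments_integrable. Qed.

Lemma mean_ge0 f : (forall w, 0 <= f w) -> 0 <= E f.
Proof. by move=> f0; apply: Rintegral_ge0. Qed.

Lemma norm_mean_le f g : all_moments f -> all_moments g ->
  (forall w, `|f w| <= g w) -> `|E f| <= E g.
Proof.
move=> af ag fg; apply: (@le_trans _ _ (E (fun w => `|f w|))).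
  by apply: le_normr_Rintegral => //; exact: all_moments_integrable.
by apply: mean_le => //; exact: all_moments_norm.
Qed.

End all_moments.

(** The space [T] is quantified because one functional is used both with the original sigma-algebra
    and with the smaller one generated by the entries other than [b j]. *)
Definition coordinatewise_measurable (R : realType) (F : (nat -> R) -> R) :=
  forall d (T : measurableType d) (x : T -> nat -> R),
    (forall i, measurable_fun setT (x ^~ i)) -> measurable_fun setT (F \o x).

(** * Independence of one entry from all the others *)

Section independence_of_coordinates.
Context d (T : measurableType d) (R : realType) (P : probability T R).
Variables (b : nat -> {RV P >-> R}) (j : nat).
Hypothesis b_independent : mutually_independent b.

Definition other_cylinders : set (set T) :=
  [set C | exists (J : {fset nat}) (A : nat -> set R), [/\ j \notin J,
    (forall i, measurable (A i)) & C = \bigcap_(i in [set` J]) b i @^-1` A i]].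

Let measurable_cylinder (J : {fset nat}) (A : nat -> set R) :
  (forall i, measurable (A i)) ->
  measurable (\bigcap_(i in [set` J]) b i @^-1` A i).
Proof.
move=> mA; apply: bigcap_measurableType => i _.
by rewrite -[_ @^-1` _]setTI; apply: measurable_funP.
Qed.

Lemma other_cylinders_measurable : other_cylinders `<=` measurable.
Proof. by move=> _ [J [A [_ mA ->]]]; exact: measurable_cylinder. Qed.

Lemma other_cylinders_setI : setI_closed other_cylinders.
Proof.
move=> _ _ [J1 [A1 [j1 m1 ->]]] [J2 [A2 [j2 m2 ->]]].
exists (J1 `|` J2)%fset, (fun i => (if i \in J1 then A1 i else setT) `&`
  (if i \in J2 then A2 i else setT)); split.
- by rewrite in_fsetU negb_or j1.
- by move=> i; apply: measurableI; case: ifP => _ //; exact: measurableT.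
- apply/seteqP; split => w /=.
    by move=> [H1 H2] i /= _; split; case: ifP => // iJ; [exact: H1|exact: H2].
  move=> H; split => i /= iJ; have := H i; rewrite /= in_fsetU iJ ?orbT.
    by move=> /(_ isT)[].
  by move=> /(_ isT)[_].
Qed.

(** For fixed [A] both sides are finite measures in [B]. They agree on the cylinders, which are
    stable under intersection, hence on the sigma-algebra they generate. *)
Lemma probability_setI_other_cylinders (A : set R) (B : set T) : measurable A ->
  <<s other_cylinders >> B ->
  P (b j @^-1` A `&` B) = (P (b j @^-1` A) * P B)%E.
Proof.
move=> mA sB.
have mbA : measurable (b j @^-1` A).
  by rewrite -[_ @^-1` _]setTI; apply: measurable_funP.
have pA : P (b j @^-1` A) \is a fin_num by rewrite fin_num_measure.
pose c : {nonneg R} := NngNum (fine_ge0 (measure_ge0 P (b j @^-1` A))).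
have cE : (c%:num%:E = P (b j @^-1` A))%E by exact: fineK.
have mscE B' : mscale c P B' = (P (b j @^-1` A) * P B')%E by rewrite -cE.
transitivity (mrestr P mbA B); first by rewrite /mrestr setIC.
transitivity (mscale c P B); last exact: mscE.
apply: (g_sigma_algebra_measure_unique other_cylinders
  other_cylinders_measurable (fun=> setT)) => //.
- move=> _; exists fset0, (fun=> setT); split => //.
  by apply/seteqP; split => // w _ i.
- by apply/seteqP; split => // w _; exists 0%N.
- exact: other_cylinders_setI.
- move=> _ [J [A' [jJ mA' ->]]]; apply: etrans (esym (mscE _)); rewrite /= /mrestr.
  pose A'' i := if i == j then A else A' i.
  have -> : \bigcap_(i in [set` J]) b i @^-1` A' i `&` b j @^-1` A =
      \bigcap_(i in [set` (j |` J)%fset]) b i @^-1` A'' i.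
    apply/seteqP; split => w /=.
      move=> [H1 H2] i /=; rewrite in_fset1U /A''; have [->//|ij /=] := eqVneq i j.
      exact: H1.
    move=> H; split.
      move=> i /= iJ; have := H i; rewrite /= in_fset1U iJ orbT => /(_ isT).
      by rewrite /A''; case: eqVneq => // ij; rewrite -ij iJ in jJ.
    by have := H j; rewrite /= in_fset1U eqxx => /(_ isT); rewrite /A'' eqxx.
  rewrite !b_independent//; last by move=> i; rewrite /A''; case: ifP.
  rewrite big_fsetU1//=; congr (_ * _)%E; first by rewrite /A'' eqxx.
  apply: eq_big_seq => i iJ; rewrite /A''; case: eqVneq => // ij.
  by rewrite -ij iJ in jJ.
- move=> _; apply: (@le_lt_trans _ _ 1%E); last exact: ltry.
  by apply: probability_le1; exact: measurableI.
Qed.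

Lemma mean_mul_drop_entry (phi : R -> R) (F : (nat -> R) -> R) :
  measurable_fun setT phi -> coordinatewise_measurable F ->
  all_moments P (phi \o b j) ->
  all_moments P (fun w => F (drop_entry j (fun i => b i w))) ->
  (\int[P]_w (phi (b j w) * F (drop_entry j (fun i => b i w))) =
  (\int[P]_w phi (b j w)) * \int[P]_w F (drop_entry j (fun i => b i w)))%R.
Proof.
move=> mphi mF aphi aF.
(* [T2] is [T] with the sigma-algebra of the other entries. The sample without entry [j] is
   measurable for it, its coordinate [j] being constant. *)
pose T2 := g_sigma_algebraType other_cylinders.
have sub : forall A : set T, <<s other_cylinders >> A -> measurable A.
  by apply: smallest_sub; [exact: sigma_algebra_measurable|
    exact: other_cylinders_measurable].
apply: (@integral_mul_of_independent _ _ _ T R T2 R P (b j) id phi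
  (fun w => F (drop_entry j (fun i => b i w)))) => //.
- by move=> _ A mA; rewrite setTI preimage_id; exact: sub.
- by move=> A B mA mB; rewrite preimage_id; exact: probability_setI_other_cylinders.
- apply: (mF _ T2 (fun w => drop_entry j (fun i => b i w))) => i.
  rewrite /drop_entry; have [_|ij] := eqVneq i j; first exact: measurable_cst.
  move=> _ A mA; rewrite setTI; apply: sub_sigma_algebra.
  exists [fset i]%fset, (fun=> A); split => //; first by rewrite inE eq_sym.
  by apply/seteqP; split => w /=; [move=> Aw k|move=> /(_ i)]; rewrite /= inE;
    [move=> /eqP->|apply].
- exact: all_moments_integrable.
- exact: all_moments_integrable.
- by apply: all_moments_integrable; exact: all_momentsM.
Qed.

End independence_of_coordinates.

(** * Stein's identity with respect to a bounded observable *)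

Section regular_functionals.
Context {R : realType}.
Implicit Types F G : (nat -> R) -> R.

(** Moments are required for every random sequence with moments, so that one closure rule per
    operation serves the full sample and all the samples with an entry removed. *)
Definition regular F := coordinatewise_measurable F /\
  forall d (T : measurableType d) (P : probability T R) (x : T -> nat -> R),
    (forall i, all_moments P (x ^~ i)) -> all_moments P (F \o x).

Lemma regular_coord i : regular (fun x => x i).
Proof. by split => [d T x mx|d T P x ax]; [exact: mx|exact: ax]. Qed.

Lemma regular_cst c : regular (fun=> c).
Proof.
by split => [d T x mx|d T P x ax]; [exact: measurable_cst|exact: all_moments_cst].
Qed.

Lemma regularD F G : regular F -> regular G -> regular (fun x => F x + G x).
Proof.
move=> [mF aF] [mG aG]; split => [d T x mx|d T P x ax].
  by apply: measurable_funD; [exact: mF|exact: mG].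
by apply: all_momentsD; [exact: aF|exact: aG].
Qed.

Lemma regularM F G : regular F -> regular G -> regular (fun x => F x * G x).
Proof.
move=> [mF aF] [mG aG]; split => [d T x mx|d T P x ax].
  by apply: measurable_funM; [exact: mF|exact: mG].
by apply: all_momentsM; [exact: aF|exact: aG].
Qed.

Lemma regularZ c F : regular F -> regular (fun x => c * F x).
Proof. exact: (regularM (regular_cst c)). Qed.

Lemma regularN F : regular F -> regular (fun x => - F x).
Proof. by move=> rF; under eq_fun do rewrite -mulN1r; exact: regularZ. Qed.

Lemma regularB F G : regular F -> regular G -> regular (fun x => F x - G x).
Proof. by move=> rF rG; apply: regularD => //; exact: regularN. Qed.

Lemma regularX F p : regular F -> regular (fun x => F x ^+ p).
Proof.
move=> rF; elim: p => [|p IHp]; first exact: regular_cst.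
by under eq_fun do rewrite exprS; exact: regularM.
Qed.

Lemma regular_sum (I : Type) (r : seq I) (F : I -> (nat -> R) -> R) :
  (forall i, regular (F i)) -> regular (fun x => \sum_(i <- r) F i x).
Proof.
move=> rF; elim: r => [|i r IHr].
  by under eq_fun do rewrite big_nil; exact: regular_cst.
by under eq_fun do rewrite big_cons; exact: regularD.
Qed.

Lemma regular_expRN F : regular F -> (forall x, 0 <= F x) ->
  regular (fun x => expR (- F x)).
Proof.
move=> [mF aF] F0; have m d (T : measurableType d) (x : T -> nat -> R) :
    (forall i, measurable_fun setT (x ^~ i)) ->
    measurable_fun setT (fun w => expR (- F (x w))).
  move=> mx; apply: measurableT_comp => //; apply: measurableT_comp => //.
  exact: mF.
split => // d T P x ax; apply: (@all_moments_le _ _ _ _ _ (cst 1)).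
- by apply: m => i; case: (ax i).
- by move=> w /=; rewrite normr1 ger0_norm ?expR_ge0// expRN_le1.
- exact: all_moments_cst.
Qed.

End regular_functionals.

Section regular_periodogram.
Context {R : realType} (N : nat).

Lemma regular_ndft_cos k : regular (@ndft_cos R N ^~ k).
Proof.
apply: regularZ; apply: regular_sum => j.
by apply: regularM; [exact: regular_coord|exact: regular_cst].
Qed.

Lemma regular_ndft_sin k : regular (@ndft_sin R N ^~ k).
Proof.
apply: regularZ; apply: regular_sum => j.
by apply: regularM; [exact: regular_coord|exact: regular_cst].
Qed.

Lemma regular_periodogram k : regular (@periodogram R N ^~ k).
Proof.
by apply: regularD; apply: regularX; [exact: regular_ndft_cos|exact: regular_ndft_sin].
Qed.

Lemma regular_aligned j k : regular (fun b => @aligned R N b j k).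
Proof.
by apply: regularD; apply: regularZ; [exact: regular_ndft_cos|exact: regular_ndft_sin].
Qed.

Lemma regular_expRN_periodogram s k : 0 <= s ->
  regular (fun b => expR (- (s * @periodogram R N b k))).
Proof.
move=> s0; apply: regular_expRN; first exact/regularZ/regular_periodogram.
by move=> b; rewrite mulr_ge0// periodogram_ge0.
Qed.

Lemma regular_periodogram_laplace s : 0 <= s -> regular (@periodogram_laplace R N s).
Proof.
move=> s0; apply: regularZ; apply: regular_sum => k.
exact: regular_expRN_periodogram.
Qed.

Lemma regular_stein_field s j : 0 <= s -> regular (@stein_field R N s ^~ j).
Proof.
move=> s0; apply: regularZ; apply: regular_sum => k.
by apply: regularM; [exact: regular_aligned|exact: regular_expRN_periodogram].
Qed.

Lemma regular_stein_field' s j : 0 <= s -> regular (@stein_field' R N s ^~ j).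
Proof.
move=> s0; apply: regularZ; apply: regular_sum => k.
apply: regularM; last exact: regular_expRN_periodogram.
by apply: regularB; [exact: regular_cst|exact/regularZ/regularX/regular_aligned].
Qed.

Lemma regular_exp_stein s : 0 <= s -> regular (@exp_stein R N s).
Proof.
move=> s0; apply: regularZ; apply: regular_sum => k.
apply: regularM; last exact: regular_expRN_periodogram.
by apply: regularB; [exact: regular_cst|exact/regularZ/regular_periodogram].
Qed.

End regular_periodogram.

(** * Elementary inequalities for powers *)

Section power_inequalities.
Context {R : realFieldType}.

Lemma sqrD_exp_le (m : nat) (x t : R) :
  (x + t) ^+ (2 * m) <= 4 ^+ m * (x ^+ (2 * m) + t ^+ (2 * m)).
Proof.
rewrite !exprM; have x2 := sqr_ge0 x; have t2 := sqr_ge0 t.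
apply: (@le_trans _ _ ((4 * Num.max (x ^+ 2) (t ^+ 2)) ^+ m)).
  rewrite lerXn2r ?nnegrE ?sqr_ge0 ?mulr_ge0 ?le_max ?x2//.
  have : x ^+ 2 <= Num.max (x ^+ 2) (t ^+ 2) by rewrite le_max lexx.
  have : t ^+ 2 <= Num.max (x ^+ 2) (t ^+ 2) by rewrite le_max lexx orbT.
  by have := sqr_ge0 (x - t); nra.
rewrite exprMn ler_wpM2l ?exprn_ge0//.
by case: (leP (x ^+ 2) (t ^+ 2)) => _; rewrite ?lerDl ?lerDr exprn_ge0.
Qed.

(** The difference of powers is [t] times [2 m + 1] products of total degree [2 m], each at most the
    larger of the two even powers. The bound is in even powers because the induction controls
    [E X^(2m)]. *)
Lemma subr_exp_odd_le (m : nat) (x t : R) :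
  `|(x + t) ^+ (2 * m).+1 - x ^+ (2 * m).+1| <=
  (2 * m).+1%:R * (4 ^+ m + 1) * (`|t| * (x ^+ (2 * m) + t ^+ (2 * m))).
Proof.
rewrite subrXX (addrC x t) addrK normrM.
rewrite [leRHS]mulrCA ler_wpM2l//.
apply: (le_trans (ler_norm_sum _ _ _)).
rewrite -mulrA mulr_natl -[X in _ *+ X]card_ord -sumr_const.
apply: ler_sum => i _; rewrite normrM !normrX.
have E (y : R) : y ^+ (2 * m) = `|y| ^+ (2 * m).
  by rewrite !exprM real_normK ?num_real.
have im : (i <= 2 * m)%N by rewrite -ltnS ltn_ord.
have := sqrD_exp_le m x t; rewrite (addrC x t) => H.
have x0 : 0 <= x ^+ (2 * m) by rewrite exprM exprn_ge0// sqr_ge0.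
have t0 : 0 <= t ^+ (2 * m) by rewrite exprM exprn_ge0// sqr_ge0.
apply: (@le_trans _ _ ((t + x) ^+ (2 * m) + x ^+ (2 * m))); last by lra.
rewrite (E (t + x)) (E x) /=.
rewrite -[in leRHS](subnK im) !exprD.
move: (`|t + x|) (`|x|) (normr_ge0 (t + x)) (normr_ge0 x) => y z y0 z0.
case: (leP y z) => yz.
  apply: (@le_trans _ _ (z ^+ (2 * m - i) * z ^+ i)).
    by rewrite ler_wpM2r ?exprn_ge0// lerXn2r ?nnegrE.
  by rewrite lerDr mulr_ge0 ?exprn_ge0.
apply: (@le_trans _ _ (y ^+ (2 * m - i) * y ^+ i)).
  by rewrite ler_wpM2l ?exprn_ge0// lerXn2r ?nnegrE// ltW.
by rewrite lerDl mulr_ge0 ?exprn_ge0.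
Qed.

Lemma norm_le_1Dsqr (x : R) : `|x| <= 1 + x ^+ 2.
Proof. by rewrite ler_norml; apply/andP; split; nra. Qed.

Lemma exprDge1_le (B : R) p q : 1 <= B -> (p <= q)%N -> B ^+ p <= B ^+ q.
Proof. by move=> B1 pq; rewrite ler_weXn2l. Qed.

End power_inequalities.

(** * Pointwise effect of removing one entry *)

Section stein_pointwise.
Context {R : realFieldType}.

(* [X], [v], [w] are the values of the observable, of the Stein field and of its
   derivative at the full sample; [x], [u], [w'] those with the entry [b] removed. *)
Record drop_estimates (C th b X x v u w w' : R) : Prop := DropEstimates {
  drop_th : 0 < th <= 1;
  drop_obs : `|X - x| <= C * (th * `|b|);
  drop_field : `|v - u - b * w'| <= C * (th * b ^+ 2);
  drop_deriv : `|w - w'| <= C * (th * `|b|);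
  drop_bound : `|w'| <= C;
  drop_le1 : `|x| <= 1 }.

Variables (C : R) (m : nat).
Hypothesis C1 : 1 <= C.

Section fix_values.
Variables (th b X x v u w w' : R).
Hypothesis H : drop_estimates C th b X x v u w w'.

(** [A] and [U] depend only on the sample without the entry and [B] only on the entry, so the mean
    of a product of them factors. *)
Local Notation A := (x ^+ (2 * m) + th ^+ (2 * m)).
Local Notation U := (1 + u ^+ 2).
Local Notation B := (1 + b ^+ 2).

Let th0 : 0 <= th. Proof. by case: H => /andP[/ltW]. Qed.
Let th1 : th <= 1. Proof. by case: H => /andP[]. Qed.
Let B1 : 1 <= B. Proof. by rewrite lerDl sqr_ge0. Qed.
Let U1 : 1 <= U. Proof. by rewrite lerDl sqr_ge0. Qed.
Let C0 : 0 <= C. Proof. exact: le_trans C1. Qed.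
Let bB : `|b| <= B. Proof. exact: norm_le_1Dsqr. Qed.
Let b2B : b ^+ 2 <= B. Proof. by rewrite lerDr. Qed.
Let even_ge0 (y : R) : 0 <= y ^+ (2 * m).
Proof. by rewrite exprM exprn_ge0// sqr_ge0. Qed.
Let A0 : 0 <= A. Proof. by rewrite addr_ge0. Qed.

Let delta_le : `|X - x| <= C * (th * B).
Proof. by apply: le_trans (drop_obs H) _; rewrite ler_wpM2l// ler_wpM2l. Qed.

Let delta_exp : (X - x) ^+ (2 * m) <= C ^+ (2 * m) * (th ^+ (2 * m) * B ^+ m).
Proof.
have -> : (X - x) ^+ (2 * m) = `|X - x| ^+ (2 * m).
  by rewrite !exprM real_normK ?num_real.
apply: (@le_trans _ _ ((C * (th * `|b|)) ^+ (2 * m))).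
  by rewrite lerXn2r ?nnegrE ?mulr_ge0// (drop_obs H).
rewrite !exprMn ler_wpM2l// ler_wpM2l//.
by rewrite exprM real_normK ?num_real// lerXn2r ?nnegrE ?sqr_ge0// addr_ge0 ?sqr_ge0.
Qed.

Lemma drop_weight_le : A <= 4 ^+ m * (1 + C ^+ (2 * m)) *
  (X ^+ (2 * m) + th ^+ (2 * m) * B ^+ m).
Proof.
have := sqrD_exp_le m X (x - X); rewrite addrCA subrr addr0 => H1.
have e : (x - X) ^+ (2 * m) = (X - x) ^+ (2 * m) by rewrite -opprB !exprM sqrrN.
rewrite e in H1.
have X0 := even_ge0 X; have t0 := even_ge0 th.
have Bm : 1 <= B ^+ m by rewrite exprn_ege1.
have tB : th ^+ (2 * m) <= th ^+ (2 * m) * B ^+ m by rewrite ler_peMr.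
have Cm : 0 <= C ^+ (2 * m) := even_ge0 C.
have F1 : (1 : R) <= 4 ^+ m by rewrite exprn_ege1// ler1n.
have d := delta_exp.
move: (th ^+ (2 * m)) (B ^+ m) (X ^+ _) (x ^+ _) (C ^+ _) (4 ^+ m) (( X - x) ^+ _)
   X0 t0 Bm tB Cm F1 d H1 => t Bm X' x' Cm F dd X0 t0 Bm1 tB Cm0 F1 d H1.
have : F * dd <= F * (Cm * (t * Bm)) by rewrite ler_wpM2l// (le_trans _ F1).
have : 0 <= F * Cm * X' by rewrite !mulr_ge0// (le_trans _ F1).
have : t * Bm <= F * (t * Bm) by rewrite ler_peMl// (le_trans t0).
by lra.
Qed.

Lemma obs_exp_le : X ^+ (2 * m) <= 4 ^+ m * C ^+ (2 * m) * (A * B ^+ m).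
Proof.
have := sqrD_exp_le m x (X - x); rewrite addrCA subrr addr0 => H1.
apply: (le_trans H1); rewrite -mulrA ler_wpM2l ?exprn_ge0//.
have Bm : 1 <= B ^+ m by rewrite exprn_ege1.
have Cm : 1 <= C ^+ (2 * m) by rewrite exprn_ege1.
rewrite mulrDl mulrDr; apply: lerD => //.
by rewrite -[leLHS]mul1r ler_pM// ler_peMr.
Qed.

(** [v = u + b * w' + r], where the last two terms have squares at most [C ^+ 2 * B ^+ 2]; the
    factor [3] comes from the square of a sum of three terms. Both directions are needed to pass
    between the samples. *)
Lemma field_sqr_le : u ^+ 2 <= 3 * v ^+ 2 + 6 * C ^+ 2 * B ^+ 2 /\
  v ^+ 2 <= 3 * u ^+ 2 + 6 * C ^+ 2 * B ^+ 2.
Proof.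
set r := v - u - b * w'.
have r2 : r ^+ 2 <= C ^+ 2 * B ^+ 2.
  rewrite -exprMn -[r ^+ 2]real_normK ?num_real// lerXn2r ?nnegrE ?mulr_ge0//.
    by rewrite addr_ge0 ?sqr_ge0.
  apply: (le_trans (drop_field H)); rewrite ler_wpM2l// -[leRHS]mul1r.
  by rewrite ler_pM ?sqr_ge0.
have s2 : (b * w') ^+ 2 <= C ^+ 2 * B ^+ 2.
  rewrite exprMn mulrC ler_pM ?sqr_ge0//.
    by rewrite -[leLHS]real_normK ?num_real// lerXn2r ?nnegrE// (drop_bound H).
  by rewrite -[leLHS]real_normK ?num_real// lerXn2r ?nnegrE// addr_ge0 ?sqr_ge0.
have vE : v = u + b * w' + r by rewrite /r; ring.
move: (b * w') r r2 s2 vE => s r r2 s2 ->.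
have := sqr_ge0 (u - s); have := sqr_ge0 (u - r); have := sqr_ge0 (s - r).
have := sqr_ge0 (u + 2 * s + r); have := sqr_ge0 (u + s + 2 * r).
have := sqr_ge0 (u + s + r + s); have := sqr_ge0 (u + s + r + r).
have := sqr_ge0 (s + r).
by split; nra.
Qed.

(** The subtracted term, in which [v] is replaced by its expansion [u + b * w'], has mean [0] for an
    independent [b] of mean [0] and variance [1]; what remains gains a factor [th]. The weight
    [B ^+ (m + 3)] collects [B ^+ m.+1] from the change of the odd power and [B ^+ 2] from
    [w - b * v]. The two summands of the constant belong to the change of the power and to the
    Taylor remainder. *)
Lemma stein_increment_le :
  `|X ^+ (2 * m).+1 * (w - b * v) -
    x ^+ (2 * m).+1 * (w' - b * u - b ^+ 2 * w')| <=
  (5 * (2 * m).+1%:R * (4 ^+ m + 1) * C ^+ (2 * m).+2 * 2 + 2 * C) *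
  (th * (A * U * B ^+ (m + 3))).
Proof.
have bn := normr_ge0 b.
have Xx : `|X ^+ (2 * m).+1 - x ^+ (2 * m).+1| <=
    (2 * m).+1%:R * (4 ^+ m + 1) * (C ^+ (2 * m).+1 * 2 * (th * (A * B ^+ m.+1))).
  have := subr_exp_odd_le m x (X - x); rewrite addrCA subrr addr0.
  move=> /le_trans; apply; rewrite ler_wpM2l ?mulr_ge0 ?addr_ge0 ?exprn_ge0//.
  apply: (@le_trans _ _ (C * (th * B) * (C ^+ (2 * m) * 2 * (A * B ^+ m)))).
    rewrite ler_pM ?addr_ge0//.
    have Bm : 1 <= B ^+ m by rewrite exprn_ege1.
    have Cm : 1 <= C ^+ (2 * m) by rewrite exprn_ege1.
    have xx := even_ge0 x; have tt := even_ge0 th.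
    have d := delta_exp.
    move: (x ^+ _) (th ^+ _) (C ^+ _) (B ^+ m) ((X - x) ^+ _) Bm Cm xx tt d.
    move=> x' t Cm Bm dd Bm1 Cm1 x0 t0 d.
    have : x' <= Cm * (x' * Bm).
      by rewrite -[leLHS]mul1r ler_pM// ler_peMr.
    have : 0 <= Cm * (x' * Bm) by rewrite !mulr_ge0// (le_trans ler01).
    have : 0 <= Cm * (t * Bm) by rewrite !mulr_ge0// (le_trans ler01).
    by lra.
  by rewrite !exprS le_eqVlt; apply/orP; left; apply/eqP; ring.
have vU : `|v| <= 3 * C * (U * B).
  have -> : v = u + b * w' + (v - u - b * w') by ring.
  apply: (le_trans (ler_normD _ _)).
  apply: (le_trans (lerD (ler_normD _ _) (drop_field H))).
  have : `|u| <= C * (U * B).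
    have uU : `|u| <= U := norm_le_1Dsqr u.
    by rewrite -[leLHS]mul1r ler_pM// -[leLHS]mulr1 ler_pM.
  have : `|b * w'| <= C * (U * B).
    rewrite normrM mulrC ler_pM ?(drop_bound H)//.
    by rewrite -[leLHS]mul1r ler_pM.
  have : C * (th * b ^+ 2) <= C * (U * B).
    rewrite ler_wpM2l// ler_pM ?sqr_ge0//.
    exact: le_trans th1 U1.
  by lra.
have wC : `|w| <= 2 * C * B.
  have -> : w = w' + (w - w') by ring.
  apply: (le_trans (ler_normD _ _)).
  apply: (le_trans (lerD (drop_bound H) (drop_deriv H))).
  have : C <= C * B by rewrite ler_peMr.
  have : C * (th * `|b|) <= C * B.
    by rewrite ler_wpM2l// -[leRHS]mul1r ler_pM.
  by lra.
have wbv : `|w - b * v| <= 5 * C * (U * B ^+ 2).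
  apply: (le_trans (ler_normB _ _)); rewrite normrM.
  have : `|w| <= 2 * C * (U * B ^+ 2).
    apply: (le_trans wC); rewrite ler_wpM2l ?mulr_ge0//.
    rewrite -[leLHS]mul1r ler_pM ?ler01//; first by rewrite (le_trans ler01).
    by rewrite expr2 ler_peMr// (le_trans ler01).
  have : `|b| * `|v| <= 3 * C * (U * B ^+ 2).
    apply: (@le_trans _ _ (B * (3 * C * (U * B)))); first by rewrite ler_pM.
    by rewrite expr2 le_eqVlt; apply/orP; left; apply/eqP; ring.
  by lra.
have rest : `|w - w' - b * (v - u - b * w')| <= 2 * C * (th * B ^+ 2).
  apply: (le_trans (ler_normB _ _)); rewrite normrM.
  have : `|w - w'| <= C * (th * B ^+ 2).
    apply: (le_trans (drop_deriv H)); rewrite ler_wpM2l// ler_wpM2l//.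
    by rewrite (le_trans bB)// expr2 ler_peMr// (le_trans ler01).
  have : `|b| * `|v - u - b * w'| <= C * (th * B ^+ 2).
    apply: (@le_trans _ _ (B * (C * (th * B)))).
      apply: ler_pM => //; apply: (le_trans (drop_field H)).
      by rewrite ler_wpM2l// ler_wpM2l.
    by rewrite expr2 le_eqVlt; apply/orP; left; apply/eqP; ring.
  by lra.
have -> : X ^+ (2 * m).+1 * (w - b * v) -
    x ^+ (2 * m).+1 * (w' - b * u - b ^+ 2 * w') =
    (X ^+ (2 * m).+1 - x ^+ (2 * m).+1) * (w - b * v) +
    x ^+ (2 * m).+1 * (w - w' - b * (v - u - b * w')) by ring.
apply: (le_trans (ler_normD _ _)); rewrite [leRHS]mulrDl; apply: lerD.
  rewrite normrM; apply: (le_trans (ler_pM _ _ Xx wbv)) => //.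
  rewrite (exprD _ m 3) !exprS expr0 le_eqVlt; apply/orP; left; apply/eqP; ring.
rewrite normrM.
have xA : `|x ^+ (2 * m).+1| <= A.
  rewrite exprSr normrM -[leRHS]mulr1; apply: ler_pM => //; last exact: drop_le1 H.
  by rewrite ger0_norm// lerDl.
apply: (le_trans (ler_pM _ _ xA rest)) => //.
rewrite (_ : A * (2 * C * (th * B ^+ 2)) = 2 * C * (th * (A * 1 * B ^+ 2))); last by ring.
rewrite ler_wpM2l ?mulr_ge0// ler_wpM2l//.
have B0 : 0 <= B := le_trans ler01 B1.
apply: ler_pM; rewrite ?mulr1 ?exprn_ge0//.
  by rewrite ler_peMr.
by rewrite exprDge1_le// addn3.
Qed.

End fix_values.
End stein_pointwise.

Ltac moments_step := lazymatch goal with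
  | |- all_moments _ (fun w => @GRing.add _ (@?f w) (GRing.opp (@?g w))) =>
      apply: (@all_momentsB _ _ _ _ f g)
  | |- all_moments _ (fun w => @GRing.add _ (@?f w) (@?g w)) =>
      apply: (@all_momentsD _ _ _ _ f g)
  | |- all_moments _ (fun w => GRing.opp (@?f w)) => apply: (@all_momentsN _ _ _ _ f)
  | |- all_moments _ (fun w => @GRing.mul _ (@?f w) (@?g w)) =>
      apply: (@all_momentsM _ _ _ _ f g)
  | |- all_moments _ (fun w => @GRing.exp _ (@?f w) ?p) =>
      apply: (@all_momentsX _ _ _ _ f p)
  | |- all_moments _ (fun w => @Num.Def.normr _ _ (@?f w)) =>
      apply: (@all_moments_norm _ _ _ _ f)
  | |- all_moments _ (fun w => \sum_(i <- _) @?F w i) =>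
      apply: all_moments_sum => ?
  end.
Ltac moments := repeat (cbv beta; moments_step); cbv beta;
  solve [assumption | done | exact: all_moments_cst | auto].

(** * Mean of the Stein average against odd powers of the Laplace error *)

Section stein_bound.
Context d (T : measurableType d) (R : realType) (P : probability T R).
Variable b : nat -> {RV P >-> R}.
Hypothesis b_independent : mutually_independent b.
Hypothesis b_moments : forall j, all_moments P (b j).
Hypothesis b_mean : forall j, (\int[P]_w b j w)%R = 0.
Hypothesis b_var : forall j, (\int[P]_w (b j w ^+ 2))%R = 1.
Variable M : nat -> R.
Hypothesis b_bound : forall j q, (\int[P]_w ((1 + b j w ^+ 2) ^+ q))%R <= M q.
Variable n : nat.

Local Notation C := (10 * n%:R + 30 : R).
Local Notation E f := (\int[P]_w f w)%R.

Definition sample w : nat -> R := fun i => b i w.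
Local Notation full w := (sample w).
Local Notation drop j w := (drop_entry j (sample w)).

Definition laplace_error (N : nat) (x : nat -> R) : R :=
  periodogram_laplace N n%:R x - n.+1%:R^-1.

Lemma regular_laplace_error N : regular (laplace_error N).
Proof.
by apply: regularB; [exact: regular_periodogram_laplace|exact: regular_cst].
Qed.

Lemma norm_laplace_error_le1 N x : (0 < N)%N -> `|laplace_error N x| <= 1.
Proof.
move=> N0; rewrite /laplace_error.
have := periodogram_laplace_ge0 N n%:R x.
have := periodogram_laplace_le1 N0 x (ler0n _ n).
have : 0 <= n.+1%:R^-1 :> R by rewrite invr_ge0.
have : n.+1%:R^-1 <= 1 :> R by rewrite invf_le1// ler1n.
move: (periodogram_laplace _ _ _) (_^-1) => y z ? ? ? ?.
by rewrite ler_norml; lra.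
Qed.

Lemma moments_full F : regular F -> all_moments P (fun w => F (full w)).
Proof. by move=> [_ aF]; apply: aF => i; exact: b_moments. Qed.

Lemma moments_drop j F : regular F -> all_moments P (fun w => F (drop j w)).
Proof.
move=> [_ aF]; apply: aF => i; rewrite /drop_entry.
by have [_|_] := eqVneq i j; [exact: all_moments_cst|exact: b_moments].
Qed.

Let moments_b j : all_moments P (fun w => b j w). Proof. exact: b_moments. Qed.

(** A polynomial in the entry covers the three cases used below: [b], [b ^+ 2] and the weights
    [(1 + b ^+ 2) ^+ q]. *)
Lemma mean_mul_drop (phi : {poly R}) j F : regular F ->
  E (fun w => phi.[b j w] * F (drop j w)) =
  E (fun w => phi.[b j w]) * E (fun w => F (drop j w)).
Proof.
move=> rF; apply: (mean_mul_drop_entry b_independent (phi := fun x => phi.[x])).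
- by apply: continuous_measurable_fun => x; exact: continuous_horner.
- by case: rF.
- have -> : (fun x : R => phi.[x]) \o b j =
      (fun w => \sum_(i < size phi) phi`_i * b j w ^+ i).
    by apply/funext => w /=; rewrite horner_coef.
  by moments.
- exact: moments_drop.
Qed.

Lemma mean_entry_drop j F : regular F -> E (fun w => b j w * F (drop j w)) = 0.
Proof.
move=> rF; have := mean_mul_drop 'X j rF.
under eq_fun do rewrite hornerX.
under [in RHS]eq_fun do rewrite hornerX.
by rewrite b_mean mul0r.
Qed.

Lemma mean_entry_sqr_drop j F : regular F ->
  E (fun w => b j w ^+ 2 * F (drop j w)) = E (fun w => F (drop j w)).
Proof.
move=> rF; have := mean_mul_drop 'X^2 j rF.
under eq_fun do rewrite hornerXn.
under [in RHS]eq_fun do rewrite hornerXn.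
by rewrite b_var mul1r.
Qed.

Lemma mean_weight_drop q j F : regular F -> (forall x, 0 <= F x) ->
  E (fun w => (1 + b j w ^+ 2) ^+ q * F (drop j w)) <=
  M q * E (fun w => F (drop j w)).
Proof.
move=> rF F0; have := mean_mul_drop ((1 + 'X^2) ^+ q) j rF.
under eq_fun do rewrite horner_exp hornerD hornerXn hornerC.
under [in RHS]eq_fun do rewrite horner_exp hornerD hornerXn hornerC.
move=> ->; rewrite ler_wpM2r// mean_ge0//.
Qed.

Section fixed_size.
Variables (N : nat) (s : R).
Hypotheses (N0 : (0 < N)%N) (sn : 0 <= s <= n%:R).

Local Notation th := (@rsqrtN R N).
Local Notation X := (laplace_error N).
Local Notation V j := (@stein_field R N s ^~ j).
Local Notation W j := (@stein_field' R N s ^~ j).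

Let s0 : 0 <= s. Proof. by case/andP: sn. Qed.
Let C1 : 1 <= C.
Proof. by have : 0 <= n%:R :> R := ler0n _ _; lra. Qed.

Lemma laplace_error_drop_estimates j w : (j < N)%N ->
  drop_estimates C th (b j w) (X (full w)) (X (drop j w))
    (V j (full w)) (V j (drop j w)) (W j (full w)) (W j (drop j w)).
Proof.
move=> jN; split.
- by rewrite rsqrtN_gt0// rsqrtN_le1.
- rewrite /laplace_error opprB addrA subrK.
  by apply: periodogram_laplace_drop => //; rewrite ler0n lexx.
- exact: stein_field_drop.
- exact: stein_field'_drop.
- apply: le_trans (stein_field'_bound N0 _ _ sn) _.
  by have : 0 <= n%:R :> R := ler0n _ _; lra.
- exact: norm_laplace_error_le1.
Qed.

Variable m : nat.
Local Notation t := (th ^+ (2 * m)).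
Local Notation A x := (X x ^+ (2 * m) + t).
Local Notation U j x := (1 + V j x ^+ 2).

Let rX : regular X. Proof. exact: regular_laplace_error. Qed.
Let rV j : regular (V j). Proof. exact: regular_stein_field. Qed.
Let rW j : regular (W j). Proof. exact: regular_stein_field'. Qed.

Let rA : regular (fun x => A x).
Proof. by apply: regularD; [exact: regularX|exact: regular_cst]. Qed.

Let rU j : regular (fun x => U j x).
Proof. by apply: regularD; [exact: regular_cst|exact: regularX]. Qed.

Let aX : all_moments P (fun w => X (full w)). Proof. exact: moments_full. Qed.
Let aV j : all_moments P (fun w => V j (full w)). Proof. exact: moments_full. Qed.
Let aW j : all_moments P (fun w => W j (full w)). Proof. exact: moments_full. Qed.
Let aX' j : all_moments P (fun w => X (drop j w)). Proof. exact: moments_drop. Qed.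
Let aV' i j : all_moments P (fun w => V i (drop j w)). Proof. exact: moments_drop. Qed.
Let aW' i j : all_moments P (fun w => W i (drop j w)). Proof. exact: moments_drop. Qed.

Let even_ge0 (y : R) : 0 <= y ^+ (2 * m).
Proof. by rewrite exprM exprn_ge0// sqr_ge0. Qed.
Let A0 x : 0 <= A x. Proof. by rewrite addr_ge0. Qed.
Let U0 j x : 0 <= U j x. Proof. by rewrite addr_ge0 ?sqr_ge0. Qed.

Lemma mean_stein_increment j : (j < N)%N ->
  `|E (fun w => X (full w) ^+ (2 * m).+1 * (W j (full w) - b j w * V j (full w)))| <=
  (5 * (2 * m).+1%:R * (4 ^+ m + 1) * C ^+ (2 * m).+2 * 2 + 2 * C) *
  (th * (M (m + 3) * E (fun w => A (drop j w) * U j (drop j w)))).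
Proof.
move=> jN; set K := (X in X * _).
have K0 : 0 <= K.
  have C0 : 0 <= C by rewrite (le_trans _ C1).
  rewrite /K; move: (C) C0 => c c0.
  apply: addr_ge0; last by rewrite mulr_ge0.
  by do ![done|apply: exprn_ge0|apply: mulr_ge0|apply: addr_ge0].
pose F x := X x ^+ (2 * m).+1 * W j x.
pose G x := X x ^+ (2 * m).+1 * V j x.
have rF : regular F by apply: regularM => //; exact: regularX.
have rG : regular G by apply: regularM => //; exact: regularX.
have aF : all_moments P (fun w => F (drop j w)) by exact: moments_drop.
have aG : all_moments P (fun w => G (drop j w)) by exact: moments_drop.
(* This is the mean-zero comparison term: [b j] has mean [0], and [1 - b j ^+ 2] has mean [0]
   because the variance is [1]. *)
have zero : E (fun w => F (drop j w) - b j w * G (drop j w) -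
    b j w ^+ 2 * F (drop j w)) = 0.
  rewrite meanB; [|by moments|by moments].
  rewrite meanB; [|by moments|by moments].
  by rewrite mean_entry_drop// mean_entry_sqr_drop// subr0 subrr.
rewrite -[X in `|X|]subr0 -zero -meanB; [|by moments|by moments].
apply: (@le_trans _ _ (E (fun w => K * (th * ((1 + b j w ^+ 2) ^+ (m + 3) *
    (A (drop j w) * U j (drop j w))))))).
  apply: norm_mean_le; [by moments|by moments|move=> w].
  have := stein_increment_le m C1 (laplace_error_drop_estimates w jN).
  rewrite -/K [X in th * X]mulrC => H; apply: le_trans H.
  by rewrite le_eqVlt; apply/orP; left; apply/eqP; congr (`| _ |); rewrite /F /G; ring.
rewrite meanZ; last by moments.
rewrite ler_wpM2l// meanZ; last by moments.
rewrite ler_wpM2l ?(ltW (rsqrtN_gt0 N0))//.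
apply: (@mean_weight_drop (m + 3) j (fun x => A x * U j x)).
  by apply: regularM; [exact: rA|exact: rU].
by move=> x; rewrite mulr_ge0.
Qed.

Let M0 q : 0 <= M q.
Proof. by apply: le_trans (b_bound 0 q); rewrite mean_ge0// => w; rewrite exprn_ge0// addr_ge0 ?sqr_ge0. Qed.

Let B0 j w : 0 <= 1 + b j w ^+ 2. Proof. by rewrite addr_ge0 ?sqr_ge0. Qed.

Local Notation K1 := (4 ^+ m * (1 + C ^+ (2 * m))).
Local Notation K2 := (4 ^+ m * C ^+ (2 * m)).
Local Notation y := (E (fun w => X (full w) ^+ (2 * m))).
Local Notation a j := (E (fun w => A (drop j w))).

Let C0 : 0 <= C. Proof. exact: le_trans C1. Qed.
Let K10 : 0 <= K1.
Proof. by do ![done|exact: M0|apply: exprn_ge0|apply: mulr_ge0|apply: addr_ge0]. Qed.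
Let K20 : 0 <= K2.
Proof. by do ![done|exact: M0|apply: exprn_ge0|apply: mulr_ge0|apply: addr_ge0]. Qed.
Let a0 j : 0 <= a j. Proof. exact: mean_ge0. Qed.

Lemma mean_drop_weight_le j : (j < N)%N -> a j <= K1 * (y + t * M m).
Proof.
move=> jN.
apply: (@le_trans _ _ (E (fun w => K1 * (X (full w) ^+ (2 * m) +
    t * (1 + b j w ^+ 2) ^+ m)))).
  apply: mean_le; [by moments|by moments|move=> w].
  exact: drop_weight_le (laplace_error_drop_estimates w jN).
rewrite meanZ; last by moments.
rewrite ler_wpM2l// meanD; [|by moments|by moments].
by rewrite lerD2l meanZ ?ler_wpM2l//; moments.
Qed.

(** Bounding the field by the entries leaves [b j ^+ 2] multiplied by an observable that depends on
    it; passing to the sample without [b j] separates the two. *)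
Lemma mean_obs_entry_sqr_le j : (j < N)%N ->
  E (fun w => X (full w) ^+ (2 * m) * b j w ^+ 2) <= K2 * (M m.+1 * a j).
Proof.
move=> jN.
apply: (@le_trans _ _ (E (fun w => K2 * ((1 + b j w ^+ 2) ^+ m.+1 * A (drop j w))))).
  apply: mean_le; [by moments|by moments|move=> w].
  have H := obs_exp_le m C1 (laplace_error_drop_estimates w jN).
  apply: (@le_trans _ _ (K2 * (A (drop j w) * (1 + b j w ^+ 2) ^+ m) *
      (1 + b j w ^+ 2))).
    by rewrite ler_pM ?sqr_ge0// lerDr.
  by rewrite (exprS (1 + _) m) le_eqVlt; apply/orP; left; apply/eqP; ring.
rewrite meanZ; last by moments.
by rewrite ler_wpM2l//; exact: (@mean_weight_drop m.+1 j (fun x => A x)).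
Qed.

(** The field is moved to the sample without [b j], where the weight factors out, and then back to
    the full sample, where the sum over [j] is controlled. The two moves produce [9 = 3 * 3] and
    [18 = 3 * 6]. *)
Lemma mean_weight_field_sqr_le j : (j < N)%N ->
  E (fun w => (1 + b j w ^+ 2) ^+ m * V j (full w) ^+ 2) <=
  9 * M m * E (fun w => V j (full w) ^+ 2) +
  (18 * C ^+ 2 * (M m * M 2) + 6 * C ^+ 2 * M (m + 2)).
Proof.
move=> jN.
apply: (@le_trans _ _ (E (fun w => 3 * ((1 + b j w ^+ 2) ^+ m * V j (drop j w) ^+ 2) +
    6 * C ^+ 2 * (1 + b j w ^+ 2) ^+ (m + 2)))).
  apply: mean_le; [by moments|by moments|move=> w].
  have [_ H] := field_sqr_le C1 (laplace_error_drop_estimates w jN).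
  rewrite exprD.
  have Bm : 0 <= (1 + b j w ^+ 2) ^+ m by rewrite exprn_ge0.
  move: ((1 + b j w ^+ 2) ^+ m) Bm => Bm Bm0.
  apply: le_trans (ler_wpM2l Bm0 H) _.
  by rewrite le_eqVlt; apply/orP; left; apply/eqP; ring.
rewrite meanD; [|by moments|by moments].
rewrite meanZ; last by moments.
rewrite meanZ; last by moments.
have H1 : E (fun w => (1 + b j w ^+ 2) ^+ m * V j (drop j w) ^+ 2) <=
    M m * E (fun w => V j (drop j w) ^+ 2).
  apply: (@mean_weight_drop m j (fun x => V j x ^+ 2)) => [|x]; last exact: sqr_ge0.
  exact: regularX.
have H2 : E (fun w => V j (drop j w) ^+ 2) <=
    3 * E (fun w => V j (full w) ^+ 2) + 6 * C ^+ 2 * M 2.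
  apply: (@le_trans _ _ (E (fun w => 3 * V j (full w) ^+ 2 +
      6 * C ^+ 2 * (1 + b j w ^+ 2) ^+ 2))).
    apply: mean_le; [by moments|by moments|move=> w].
    by have [] := field_sqr_le C1 (laplace_error_drop_estimates w jN).
  rewrite meanD; [|by moments|by moments].
  rewrite meanZ; last by moments.
  rewrite meanZ; last by moments.
  by rewrite lerD2l ler_wpM2l// mulr_ge0// exprn_ge0.
have H3 := ler_wpM2l (M0 m) H2.
have H4 : 6 * C ^+ 2 * E (fun w => (1 + b j w ^+ 2) ^+ (m + 2)) <=
    6 * C ^+ 2 * M (m + 2) by rewrite ler_wpM2l// mulr_ge0// exprn_ge0.
apply: (le_trans (lerD (ler_wpM2l _ (le_trans H1 H3)) H4)) => //.
by rewrite le_eqVlt; apply/orP; left; apply/eqP; ring.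
Qed.

Local Notation K3 := ((1 + 6 * C ^+ 2 * M 2 + 3 * K1 * (K2 * M m.+1)) * (K1 * (1 + M m)) +
  3 * K1 * (9 * M m + (18 * C ^+ 2 * (M m * M 2) + 6 * C ^+ 2 * M (m + 2)))).

(** On the left each summand lives on a different sample, so [sum_stein_field_sqr] does not apply.
    All terms containing the field are moved to the full sample, summed over [j] there, and the
    resulting [b j ^+ 2] is separated from the observable once more. *)
Lemma sum_mean_weight_le :
  \sum_(j < N) E (fun w => A (drop j w) * U j (drop j w)) <= N%:R * (K3 * (y + t)).
Proof.
have y0 : 0 <= y by exact: mean_ge0.
have t0 : 0 <= t by exact: even_ge0.
have c2 : 0 <= C ^+ 2 := exprn_ge0 2 C0.
have step j : (j < N)%N -> E (fun w => A (drop j w) * U j (drop j w)) <=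
    (1 + 6 * C ^+ 2 * M 2) * a j +
    3 * K1 * (E (fun w => X (full w) ^+ (2 * m) * V j (full w) ^+ 2) +
      t * E (fun w => (1 + b j w ^+ 2) ^+ m * V j (full w) ^+ 2)).
  move=> jN.
  apply: (@le_trans _ _ (E (fun w => A (drop j w) +
      6 * C ^+ 2 * ((1 + b j w ^+ 2) ^+ 2 * A (drop j w)) +
      3 * K1 * (X (full w) ^+ (2 * m) * V j (full w) ^+ 2 +
        t * ((1 + b j w ^+ 2) ^+ m * V j (full w) ^+ 2))))).
    apply: mean_le; [by moments|by moments|move=> w].
    have D := laplace_error_drop_estimates w jN.
    have [H _] := field_sqr_le C1 D; have G := drop_weight_le m C1 D.
    have {}H := ler_wpM2l (A0 (drop j w)) H.
    have {}G := ler_wpM2r (sqr_ge0 (V j (full w))) G.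
    move: (K1) (C ^+ 2) (A (drop j w)) G H => k c aa G H.
    by lra.
  rewrite meanD; [|by moments|by moments].
  rewrite meanD; [|by moments|by moments].
  rewrite meanZ; last by moments.
  rewrite meanZ; last by moments.
  rewrite (meanD (f := fun w => X (full w) ^+ (2 * m) * V j (full w) ^+ 2));
    [|by moments|by moments].
  rewrite (meanZ (th ^+ (2 * m))); last by moments.
  rewrite lerD2r [leRHS]mulrDl mul1r lerD2l -[leRHS]mulrA.
  rewrite ler_wpM2l ?mulr_ge0//.
  exact: (@mean_weight_drop 2 j (fun x => A x)).
have sumV : \sum_(j < N) E (fun w => X (full w) ^+ (2 * m) * V j (full w) ^+ 2) <=
    \sum_(j < N) E (fun w => X (full w) ^+ (2 * m) * b j w ^+ 2).
  rewrite -mean_sum; last by move=> j; moments.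
  rewrite -mean_sum; last by move=> j; moments.
  apply: mean_le; [by moments|by moments|move=> w].
  by rewrite -!mulr_sumr ler_wpM2l//; exact: sum_stein_field_sqr.
have sumV1 : \sum_(j < N) E (fun w => V j (full w) ^+ 2) <= N%:R.
  rewrite -mean_sum; last by move=> j; moments.
  apply: (@le_trans _ _ (E (fun w => \sum_(j < N) b j w ^+ 2))).
    apply: mean_le; [by moments|by moments|move=> w].
    exact: sum_stein_field_sqr.
  rewrite mean_sum; last by move=> j; moments.
  by under eq_bigr do rewrite b_var; rewrite sumr_const card_ord.
apply: (le_trans (ler_sum _ (fun (j : 'I_N) _ => step j (ltn_ord j)))).
rewrite big_split/= -!mulr_sumr big_split/= -mulr_sumr.
set Sa := \sum_(j < N) a j.
have Sa_le : Sa <= N%:R * (K1 * (y + t * M m)).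
  apply: (@le_trans _ _ (\sum_(j < N) (K1 * (y + t * M m)))).
    by apply: ler_sum => j _; exact: mean_drop_weight_le.
  by rewrite sumr_const card_ord -[leLHS]mulr_natl.
have S1 : \sum_(j < N) E (fun w => X (full w) ^+ (2 * m) * V j (full w) ^+ 2) <=
    K2 * M m.+1 * Sa.
  apply: (le_trans sumV); rewrite mulr_sumr; apply: ler_sum => j _.
  by rewrite -mulrA; exact: mean_obs_entry_sqr_le.
set c3 := 18 * C ^+ 2 * (M m * M 2) + 6 * C ^+ 2 * M (m + 2).
have c30 : 0 <= c3.
  rewrite /c3; by do ![done|exact: M0|apply: exprn_ge0|apply: mulr_ge0|apply: addr_ge0].
have S2 : \sum_(j < N) E (fun w => (1 + b j w ^+ 2) ^+ m * V j (full w) ^+ 2) <=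
    N%:R * (9 * M m + c3).
  apply: (@le_trans _ _ (\sum_(j < N) (9 * M m * E (fun w => V j (full w) ^+ 2) + c3))).
    by apply: ler_sum => j _; exact: mean_weight_field_sqr_le.
  rewrite big_split/= -mulr_sumr sumr_const card_ord -[c3 *+ N]mulr_natl [leRHS]mulrDr lerD2r.
  by rewrite mulrC ler_wpM2r// mulr_ge0.
have Mm := M0 m; have Mm1 := M0 m.+1; have M2 := M0 2.
have N0R : 0 <= N%:R :> R by [].
have k1 := K10; have k2 := K20.
move: (K1) (K2) k1 k2 Sa_le S1 => k1 k2 k10 k20 Sa_le S1.
have Sa0 : 0 <= Sa by rewrite sumr_ge0.
have e1 : 0 <= 1 + 6 * C ^+ 2 * M 2 + 3 * k1 * (k2 * M m.+1).
  by do ![done|exact: M0|apply: exprn_ge0|apply: mulr_ge0|apply: addr_ge0].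
have tt : y + t * M m <= (1 + M m) * (y + t).
  have : 0 <= M m * y by exact: mulr_ge0.
  by lra.
have F1 := ler_wpM2l e1 (le_trans Sa_le (ler_wpM2l N0R (ler_wpM2l k10 tt))).
have k30 : 0 <= 3 * k1 by exact: mulr_ge0.
have F2 := ler_wpM2l k30 S1.
have F3 := ler_wpM2l (mulr_ge0 k30 t0) S2.
have F4 : 0 <= 3 * k1 * (N%:R * (9 * M m + c3)) * y.
  by do ![done|exact: M0|apply: exprn_ge0|apply: mulr_ge0|apply: addr_ge0].
move: (\sum_(j < N) E (fun w => _ * V j (full w) ^+ 2)) F2 F3 => s1 F2 F3.
move: (\sum_(j < N) E (fun w => _ * V j (full w) ^+ 2)) F3 F2 => s2 F3 F2.
have {Sa_le S1 Sa0 c30 S2 sumV sumV1 step} : True by [].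
move: Sa F1 F2 => Sa F1 F2.
move: (y) (t) (C ^+ 2) c3 F1 F2 F3 F4 => y' t' c' c3' F1 F2 F3 F4 _.
by lra.
Qed.

Local Notation K := (5 * (2 * m).+1%:R * (4 ^+ m + 1) * C ^+ (2 * m).+2 * 2 + 2 * C).

Lemma mean_obs_exp_stein_le :
  `|E (fun w => X (full w) ^+ (2 * m).+1 * exp_stein N s (full w))| <=
  (K * (M (m + 3) * K3) + 2) * (th * (y + t)).
Proof.
have y0 : 0 <= y by exact: mean_ge0.
have t0 : 0 <= t by exact: even_ge0.
have th0 : 0 < th := rsqrtN_gt0 N0.
have K0 : 0 <= K.
  by do ![done|exact: M0|apply: exprn_ge0|apply: mulr_ge0|apply: addr_ge0].
have NR : 0 < N%:R :> R by rewrite ltr0n.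
have aD : all_moments P (fun w => exp_stein N s (full w)).
  exact/moments_full/regular_exp_stein.
rewrite -(ler_pM2l NR) -[X in X * `|_|]gtr0_norm// -normrM -meanZ; last by moments.
apply: (@le_trans _ _ (`|\sum_(j < N) E (fun w => X (full w) ^+ (2 * m).+1 *
    (W j (full w) - b j w * V j (full w)))| + 2 * y)).
  rewrite -mean_sum; last by move=> j; moments.
  rewrite -[X in `|X|](subrK (E (fun w => \sum_(j < N) X (full w) ^+ (2 * m).+1 *
    (W j (full w) - b j w * V j (full w))))) addrC.
  apply: (le_trans (ler_normD _ _)); rewrite lerD2l -meanB; [|by moments|by moments].
  rewrite -meanZ; last by moments.
  apply: norm_mean_le; [by moments|by moments|move=> w].
  rewrite -mulr_sumr mulrCA -mulrBr normrM mulrC.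
  have := stein_identity N0 (full w) s0; rewrite -normrN opprB => H.
  apply: ler_pM => //.
  rewrite exprS normrM -[leRHS]mul1r; apply: ler_pM => //.
    exact: norm_laplace_error_le1.
  by rewrite ger0_norm.
apply: (@le_trans _ _ (K * (th * (M (m + 3) * (N%:R * (K3 * (y + t))))) + 2 * y)).
  rewrite lerD2r; apply: (le_trans (ler_norm_sum _ _ _)).
  apply: (@le_trans _ _ (\sum_(j < N) K * (th * (M (m + 3) *
      E (fun w => A (drop j w) * U j (drop j w)))))).
    by apply: ler_sum => j _; exact: mean_stein_increment.
  rewrite -!mulr_sumr ler_wpM2l// ler_wpM2l ?(ltW th0)// ler_wpM2l//.
  exact: sum_mean_weight_le.
(* The error [2] of [stein_identity] is absorbed because [N * th >= 1]. *)
have : 2 * y <= N%:R * (2 * (th * (y + t))).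
  rewrite (_ : N%:R * _ = 2 * ((N%:R * th) * (y + t))); last by ring.
  rewrite ler_wpM2l//.
  have Nth : 1 <= N%:R * th.
    have : th ^+ 2 = N%:R^-1 by exact: rsqrtN_sqr.
    have : th <= 1 by exact: rsqrtN_le1.
    rewrite -(ler_pM2r th0) mul1r -mulrA -expr2 => + ->.
    by rewrite mulfV ?gt_eqF.
  rewrite -[leLHS]mul1r; apply: ler_pM => //.
  by rewrite lerDl.
move: (K) (K3) (y + t) => k k3 yt; lra.
Qed.

End fixed_size.
End stein_bound.

(** * Almost sure convergence of the Laplace transforms *)

(** This replaces integration over [s], without differentiating under the mean: over [r] equal steps
    the quadratic remainders add up to [g S^2 / r], which vanishes as [r] grows. So [g] may be any
    constant, even one depending on [N]. *)
Lemma increment_bound (R : realType) (rho : R -> R) (S B g : R) : 0 <= S ->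
  (forall s t, 0 <= s -> 0 <= t -> s + t <= S ->
    `|rho (s + t) - rho s| <= B * t + g * t ^+ 2) ->
  `|rho S - rho 0| <= B * S.
Proof.
move=> S0 H; apply/ler_addgt0Pr => e e0.
have g0 : 0 <= `|g| * S ^+ 2 by rewrite mulr_ge0// sqr_ge0.
pose r := (Num.truncn (`|g| * S ^+ 2 / e)).+1.
have r0 : 0 < r%:R :> R by rewrite ltr0n.
pose t := S / r%:R.
have t0 : 0 <= t by rewrite divr_ge0// ltW.
have steps (i : nat) : (i <= r)%N ->
    `|rho (i%:R * t) - rho 0| <= i%:R * (B * t + g * t ^+ 2).
  elim: i => [|i IHi] ir; first by rewrite !mul0r subrr normr0.
  have -> : i.+1%:R * t = i%:R * t + t by rewrite -natr1; ring.
  rewrite -(subrK (rho (i%:R * t)) (rho (_ + t))) -addrA.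
  apply: (le_trans (ler_normD _ _)); rewrite -natr1 [leRHS]mulrDl mul1r [leRHS]addrC.
  apply: lerD; last by apply: IHi; exact: ltnW.
  apply: H => //; first by rewrite mulr_ge0.
  rewrite -[X in _ + X]mul1r -mulrDl natr1 /t mulrCA -[leRHS]mulr1 ler_wpM2l//.
  by rewrite ler_pdivrMr// mul1r ler_nat.
have := steps r (leqnn r); rewrite {1}/t mulrC mulfVK ?gt_eqF// => /le_trans; apply.
rewrite mulrDr (_ : r%:R * (B * t) = B * S); last first.
  by rewrite /t; field; rewrite gt_eqF.
rewrite lerD2l (_ : r%:R * (g * t ^+ 2) = g * S ^+ 2 / r%:R); last first.
  by rewrite /t; field; rewrite gt_eqF.
apply: (@le_trans _ _ (`|g| * S ^+ 2 / r%:R)).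
  by rewrite ler_wpM2r ?invr_ge0 ?(ltW r0)// ler_wpM2r ?sqr_ge0// ler_norm.
rewrite ler_pdivrMr// [leRHS]mulrC -ler_pdivrMr//.
by rewrite ltW// /r truncnS_gt.
Qed.

(** Telescoping: [1 / x^2 <= 2 / x - 2 / (x + 1)] for [x >= 1]. *)
Lemma sum_inv_sqr_le (R : realFieldType) (r : nat) :
  \sum_(i < r) (i.+1%:R ^+ 2 : R)^-1 <= 2 - 2 / r.+1%:R.
Proof.
elim: r => [|r IHr]; first by rewrite big_ord0 divr1 subrr.
rewrite big_ord_recr/=; apply: (le_trans (lerD IHr (lexx _))).
have r1 : 0 < r.+1%:R :> R by [].
have -> : r.+2%:R = r.+1%:R + 1 :> R by rewrite natr1.
have r11 : 1 <= r.+1%:R :> R by rewrite ler1n.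
move: (r.+1%:R) r1 r11 => x x0 x1.
rewrite -subr_ge0 (_ : _ - _ = (x - 1) / (x ^+ 2 * (x + 1))); last first.
  by field; rewrite !gt_eqF//; lra.
rewrite divr_ge0 ?subr_ge0// mulr_ge0 ?sqr_ge0//; lra.
Qed.

(** By monotone convergence the series has a finite mean, so it is finite almost everywhere and its
    terms tend to [0] there. *)
Lemma ae_cvg0_of_summable_mean d (T : measurableType d) (R : realType)
    (P : probability T R) (f : nat -> T -> R) (K : R) :
  (forall i, all_moments P (f i)) -> (forall i w, 0 <= f i w) ->
  (forall r, \sum_(i < r) (\int[P]_w f i w)%R <= K) ->
  {ae P, forall w, f ^~ w @ \oo --> 0}.
Proof.
move=> af f0 fK.
have mf i : measurable_fun setT (EFin \o f i).
  by apply/measurable_EFinP; case: (af i).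
pose F w := (\sum_(i <oo) (f i w)%:E)%E.
have F0 w : (0 <= F w)%E by apply: nneseries_ge0 => i _ _; rewrite lee_fin.
have mF : measurable_fun setT F.
  by apply: ge0_emeasurable_sum => [i w _ _|i _]; [rewrite lee_fin|exact: mf].
have IF : P.-integrable setT F.
  apply/integrableP; split => //; under eq_integral do rewrite gee0_abs//.
  rewrite integral_nneseries//; last by move=> i w _; rewrite lee_fin.
  apply: (@le_lt_trans _ _ K%:E); last exact: ltry.
  apply: lime_le.
    by apply: is_cvg_nneseries => i _ _; apply: integral_ge0 => w _; rewrite lee_fin.
  apply: nearW => r; apply: le_trans (_ : _ <= (\sum_(i < r) (\int[P]_w f i w)%R)%:E)%E _.
    rewrite big_mkord -sumEFin; apply: lee_sum => i _.
    by rewrite /Rintegral fineK//; apply: integrable_fin_num => //; exact: all_moments_integrable.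
  by rewrite lee_fin.
have := integrable_ae measurableT IF; apply: filterS => w /(_ I) Ffin.
apply: cvg_series_cvg_0; apply: nondecreasing_is_cvgn.
  by apply: nondecreasing_series => i _ _; exact: f0.
exists (fine (F w)) => _ [r _ <-].
rewrite -lee_fin fineK// /series/= -sumEFin.
by apply: nneseries_lim_ge => i _ _; rewrite lee_fin.
Qed.

Lemma expRN_taylor_le (R : realType) (x : R) : 0 <= x ->
  `|expR (- x) - 1 + x| <= x ^+ 2 /\ `|expR (- x) - 1| <= x.
Proof.
move=> x0; have e1 := expRN_le1 x0; have ge := expR_ge1Dx (- x).
have x20 := sqr_ge0 x.
have le2 : expR (- x) <= 1 - x + x ^+ 2.
  rewrite expRN; apply: (@le_trans _ _ (1 + x)^-1).
    rewrite lef_pV2 ?posrE ?expR_gt0//; last by lra.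
    exact: expR_ge1Dx.
  rewrite -[leLHS]mul1r ler_pdivrMr; last by lra.
  rewrite (_ : _ * _ = 1 + x ^+ 3); last by ring.
  by rewrite lerDl exprn_ge0.
by split; rewrite ler_norml; apply/andP; split; lra.
Qed.

(** The derivative of [(1 + s) exp (- s y)] is [(1 - (1 + s) y) exp (- s y)], the summand of
    [exp_stein]; the remainder is a polynomial in the periodogram and hence has a finite mean. *)
Lemma laplace_increment_le (R : realType) (N : nat) (S s t : R) (x : nat -> R) :
  (0 < N)%N -> 0 <= s -> 0 <= t -> s + t <= S ->
  `|(1 + (s + t)) * periodogram_laplace N (s + t) x - (1 + s) * periodogram_laplace N s x -
    t * exp_stein N s x| <=
  t ^+ 2 * (N%:R^-1 * \sum_(k < N) ((1 + S) * periodogram N x k ^+ 2 + periodogram N x k)).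
Proof.
move=> N0 s0 t0 stS; rewrite /periodogram_laplace /exp_stein.
rewrite ![_ * (N%:R^-1 * _)]mulrCA -!mulrBr normrM ger0_norm ?invr_ge0//.
rewrite ler_wpM2l ?invr_ge0// !mulr_sumr -!sumrB.
apply: (le_trans (ler_norm_sum _ _ _)); apply: ler_sum => k _.
have y0 := periodogram_ge0 N x k; move: (periodogram N x k) y0 => y y0.
have -> : expR (- ((s + t) * y)) = expR (- (s * y)) * expR (- (t * y)).
  by rewrite -expRD; congr expR; ring.
have e0 := expR_ge0 (- (s * y)).
have e1 : expR (- (s * y)) <= 1 by rewrite expRN_le1// mulr_ge0.
have [H1 H2] := expRN_taylor_le (mulr_ge0 t0 y0).
move: (expR (- (s * y))) (expR (- (t * y))) e0 e1 H1 H2 => e f e0 e1 H1 H2.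
rewrite (_ : _ - _ - _ = e * ((1 + s) * (f - 1 + t * y) + t * (f - 1))); last by ring.
rewrite normrM ger0_norm// -[leRHS]mul1r; apply: ler_pM => //.
apply: (le_trans (ler_normD _ _)); rewrite !normrM (ger0_norm t0).
rewrite (ger0_norm (_ : 0 <= 1 + s)); last by lra.
have s1 : 1 + s <= 1 + S by lra.
have ss : 0 <= 1 + s by lra.
have T1 := ler_pM ss (normr_ge0 _) s1 H1.
have T2 := ler_wpM2l t0 H2.
by lra.
Qed.

(** * Decay of the moments of the Laplace error *)

Section moment_decay.
Context d (T : measurableType d) (R : realType) (P : probability T R).
Variable b : nat -> {RV P >-> R}.
Hypothesis b_independent : mutually_independent b.
Hypothesis b_moments : forall j, all_moments P (b j).
Hypothesis b_mean : forall j, (\int[P]_w b j w)%R = 0.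
Hypothesis b_var : forall j, (\int[P]_w (b j w ^+ 2))%R = 1.
Variable M : nat -> R.
Hypothesis b_bound : forall j q, (\int[P]_w ((1 + b j w ^+ 2) ^+ q))%R <= M q.
Variable n : nat.

Local Notation E f := (\int[P]_w f w)%R.
Local Notation full w := (sample b w).
Local Notation X N := (laplace_error n N).
Local Notation th N := (@rsqrtN R N).

(** Let [rho s] be the mean of [X^(2m+1) (1 + s) Phi (s)], with [X] taken at the fixed [n]. Since
    [Phi (0) = 1], the difference [(1 + n) Phi (n) - 1] is [(1 + n) X], so [rho n - rho 0] is
    [(1 + n) E X^(2m+2)]; the increments of [rho] bound it by [K n]. *)
Lemma mean_laplace_error_step (m N : nat) (K : R) : (0 < N)%N ->
  (forall s, 0 <= s <= n%:R ->
    `|E (fun w => X N (full w) ^+ (2 * m).+1 * exp_stein N s (full w))| <= K) ->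
  E (fun w => X N (full w) ^+ (2 * m.+1)) <= K.
Proof.
move=> N0 HK.
have K0 : 0 <= K by apply: le_trans (HK 0 _); rewrite ?lexx/=.
pose p := (2 * m).+1.
have aX : all_moments P (fun w => X N (full w)).
  exact/(moments_full b_moments)/regular_laplace_error.
have aL s : 0 <= s -> all_moments P (fun w => periodogram_laplace N s (full w)).
  by move=> s0; exact/(moments_full b_moments)/regular_periodogram_laplace.
have aD s : 0 <= s -> all_moments P (fun w => exp_stein N s (full w)).
  by move=> s0; exact/(moments_full b_moments)/regular_exp_stein.
pose G x := N%:R^-1 * \sum_(k < N) ((1 + n%:R : R) * periodogram N x k ^+ 2 +
  periodogram N x k).
have aG : all_moments P (fun w => G (full w)).
  apply/(moments_full b_moments)/regularZ; apply: regular_sum => k.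
  by apply: regularD; [apply/regularZ/regularX|]; exact: regular_periodogram.
pose rho s := E (fun w => X N (full w) ^+ p * ((1 + s) * periodogram_laplace N s (full w))).
have H : `|rho n%:R - rho 0| <= K * n%:R.
  apply: (@increment_bound R rho n%:R K (E (fun w => G (full w)))) => // s t s0 t0 st.
  have as0 := aL _ s0; have asd := aD _ s0.
  have ast := aL _ (addr_ge0 s0 t0).
  rewrite /rho -meanB; [|by moments|by moments].
  rewrite -[Y in `|Y|](subrK (t * E (fun w => X N (full w) ^+ p *
    exp_stein N s (full w)))) addrC.
  apply: (le_trans (ler_normD _ _)); apply: lerD.
    rewrite normrM (ger0_norm t0) mulrC ler_wpM2r//; apply: HK; rewrite s0/=.
    by apply: le_trans st; rewrite lerDl.
  rewrite -meanZ; last by moments.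
  rewrite -meanB; [|by moments|by moments].
  rewrite [leRHS]mulrC -meanZ; last by moments.
  apply: norm_mean_le; [by moments|by moments|move=> w].
  rewrite (mulrCA t) -!mulrBr normrM -[leRHS]mul1r; apply: ler_pM => //.
    by rewrite normrX exprn_ile1//; exact: norm_laplace_error_le1.
  exact: laplace_increment_le.
have E1 : rho n%:R - rho 0 = (1 + n%:R) * E (fun w => X N (full w) ^+ (2 * m.+1)).
  rewrite /rho.
  have := aL _ (lexx 0); have := aL _ (ler0n R n) => ? ?.
  rewrite -meanB; [|by moments|by moments].
  rewrite -meanZ; last by moments.
  apply: eq_Rintegral => w _.
  have L0 : periodogram_laplace N 0 (full w) = 1.
    rewrite /periodogram_laplace; under eq_bigr do rewrite mul0r oppr0 expR0.
    by rewrite sumr_const card_ord mulVf// pnatr_eq0 -lt0n.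
  rewrite L0 /p mulnS addSn add1n !exprS /laplace_error.
  have : n.+1%:R != 0 :> R by [].
  rewrite -natr1; move: (periodogram_laplace _ _ _) (_ ^+ (2 * m)) => l z n1.
  by field; rewrite addrC.
have y0 : 0 <= E (fun w => X N (full w) ^+ (2 * m.+1)).
  by apply: mean_ge0 => w; rewrite exprM exprn_ge0// sqr_ge0.
have n0 : 0 <= n%:R :> R by [].
move: H; rewrite E1 ger0_norm ?mulr_ge0 ?addr_ge0// => H.
have : (1 + n%:R) * E (fun w => X N (full w) ^+ (2 * m.+1)) <= (1 + n%:R) * K.
  by apply: (le_trans H); rewrite mulrDl mul1r mulrC lerDr.
by rewrite ler_pM2l// ltr_pwDl.
Qed.

Lemma mean_laplace_error_decay m : exists2 K, 0 <= K &
  forall N, (0 < N)%N -> E (fun w => X N (full w) ^+ (2 * m)) <= K * th N ^+ m.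
Proof.
elim: m => [|m [K K0 IHm]].
  exists 1 => // N N0; under eq_Rintegral do rewrite muln0 expr0.
  by rewrite mean_cst mul1r.
have H N s (N0 : (0 < N)%N) (sn : 0 <= s <= n%:R) :=
  mean_obs_exp_stein_le b_independent b_moments b_mean b_var b_bound N0 sn m.
move: H; set c := (_ + 2 : R) => H.
exists (`|c| * (K + 1)); first by rewrite mulr_ge0// addr_ge0.
move=> N N0.
have th0 : 0 < th N := rsqrtN_gt0 N0.
apply: (mean_laplace_error_step N0) => s sn.
apply: (le_trans (H N s N0 sn)).
apply: (@le_trans _ _ (`|c| * (th N * ((K + 1) * th N ^+ m)))); last first.
  by rewrite exprS le_eqVlt; apply/orP; left; apply/eqP; ring.
have y0 : 0 <= E (fun w => X N (full w) ^+ (2 * m)).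
  by apply: mean_ge0 => w; rewrite exprM exprn_ge0// sqr_ge0.
have t2 : th N ^+ (2 * m) <= th N ^+ m.
  have t1 : th N <= 1 by exact: rsqrtN_le1.
  by rewrite ler_wiXn2l ?(ltW th0)// leq_pmull.
apply: (@le_trans _ _ (`|c| * (th N * (E (fun w => X N (full w) ^+ (2 * m)) +
    th N ^+ (2 * m))))).
  rewrite ler_wpM2r ?ler_norm// mulr_ge0 ?(ltW th0)// addr_ge0//.
  by rewrite exprn_ge0// ltW.
rewrite ler_wpM2l// ler_wpM2l ?(ltW th0)// mulrDl mul1r; apply: lerD => //.
exact: IHm.
Qed.

Lemma ae_laplace_error_cvg0 :
  {ae P, forall w, (fun N => X N.+1 (full w)) @ \oo --> 0}.
Proof.
have [K K0 HK] := mean_laplace_error_decay 4.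
have aX N : all_moments P (fun w => X N (full w)).
  exact/(moments_full b_moments)/regular_laplace_error.
have := @ae_cvg0_of_summable_mean _ _ _ P (fun N w => X N.+1 (full w) ^+ (2 * 4)) (K * 2).
have aX8 i : all_moments P (fun w => X i.+1 (full w) ^+ (2 * 4)) by moments.
move=> /(_ aX8); case.
- by move=> N w; rewrite exprM exprn_ge0// sqr_ge0.
- move=> r; apply: (@le_trans _ _ (\sum_(i < r) K * (i.+1%:R ^+ 2)^-1)).
    apply: ler_sum => i _; apply: (le_trans (HK i.+1 isT)).
    (* The fourth power of [rsqrtN] is the inverse square of the size. *)
    by rewrite (exprM _ 2 2) rsqrtN_sqr// exprVn.
  rewrite -mulr_sumr ler_wpM2l//; apply: (le_trans (sum_inv_sqr_le _ _)).
  by rewrite lerBlDr lerDl divr_ge0.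
move=> A [mA PA sA]; exists A; split => // w Hw; apply: sA => /= H; apply: Hw.
apply/cvgr0Pnorm_lt => e e0.
have e8 : 0 < e ^+ (2 * 4) by exact: exprn_gt0.
move/cvgr0Pnorm_lt : H => /(_ _ e8); apply: filterS => N.
by rewrite normrX ltr_pXn2r ?nnegrE ?(ltW e0).
Qed.

End moment_decay.

(** * Bernstein approximation and the Rayleigh law *)

Section bernstein.
Context {R : realType}.
Implicit Types (f g : nat -> R) (u : R).

(* De Casteljau's recursion. *)
Fixpoint bernstein (n : nat) f : {poly R} :=
  if n is n'.+1 then 'X * bernstein n' (f \o succn) + (1 - 'X) * bernstein n' f
  else (f 0%N)%:P.

Lemma bernsteinS n f u : (bernstein n.+1 f).[u] =
  u * (bernstein n (f \o succn)).[u] + (1 - u) * (bernstein n f).[u].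
Proof. by rewrite /= hornerD !hornerM hornerD hornerN hornerX hornerC. Qed.

Lemma bernstein_affine n f a c u :
  (bernstein n (fun i => a * f i + c)).[u] = a * (bernstein n f).[u] + c.
Proof.
elim: n f => [|n IHn] f; first by rewrite /= !hornerC.
rewrite !bernsteinS (IHn (f \o succn)) IHn; ring.
Qed.

Lemma bernstein_le n f g u : 0 <= u <= 1 ->
  (forall i, (i <= n)%N -> f i <= g i) -> (bernstein n f).[u] <= (bernstein n g).[u].
Proof.
move=> u01; elim: n f g => [|n IHn] f g fg; first by rewrite /= !hornerC fg.
have /andP[u0 u1] := u01.
rewrite !bernsteinS; apply: lerD; apply: ler_wpM2l; rewrite ?subr_ge0//.
  by apply: IHn => i ni; exact: fg.
by apply: IHn => i ni; apply: fg; exact: leqW.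
Qed.

(** The value at [u] is the mean of [f] under the binomial law of parameters [n] and [u]; this is
    its second moment about [c]. The centre is general because the shift by [succn] moves it to
    [c - 1]. *)
Lemma bernstein_variance n (c : R) u :
  (bernstein n (fun i => (i%:R - c) ^+ 2)).[u] =
  (n%:R * u - c) ^+ 2 + n%:R * u * (1 - u).
Proof.
elim: n c => [|n IHn] c; first by rewrite /= hornerC !mul0r addr0.
rewrite bernsteinS IHn.
have -> : (fun i => (i%:R - c) ^+ 2) \o succn = fun i : nat => (i%:R - (c - 1)) ^+ 2.
  by apply/funext => i /=; rewrite -natr1; ring.
rewrite IHn -natr1; ring.
Qed.

(** Compactness is used as a near-covering property, with [dl] tending to [0] from the right as the
    parameter. Only [x] is confined to the interval. *)
Lemma uniformly_continuous_unit_interval (psi : R -> R) (e : R) :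
  continuous psi -> 0 < e -> exists2 dl : R, 0 < dl &
    forall x y : R, 0 <= x <= 1 -> `|y - x| < dl -> `|psi y - psi x| < e.
Proof.
move=> cpsi e0.
have cK : near_covering (`[0, 1]%classic : set R).
  by apply/compact_near_coveringP; exact: segment_compact.
have := cK R (0 : R)^'+ (fun dl x : R => forall y : R, `|y - x| < dl -> `|psi y - psi x| < e) _.
case.
- move=> c _; have e20 : 0 < e / 2 by rewrite divr_gt0.
  have /cvgrPdist_lt/(_ _ e20)/nbhs_ballP[r /= r0 Hr] := cpsi c.
  have r20 : 0 < r / 2 by rewrite divr_gt0.
  exists (ball c (r / 2), [set dl | dl < r / 2]) => /=.
    by split; [exact: nbhsx_ballx|exact: nbhs_right_lt].
  move=> [x dl] [/= xc dlr] y yx.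
  have H1 : `|psi c - psi x| < e / 2.
    by apply: Hr; apply: (le_ball _ xc); lra.
  have H2 : `|psi c - psi y| < e / 2.
    apply: Hr; rewrite /ball/=.
    have xc' : `|c - x| < r / 2 := xc.
    have -> : c - y = (c - x) - (y - x) by ring.
    by apply: le_lt_trans (ler_normB _ _) _; lra.
  have -> : psi y - psi x = (psi c - psi x) - (psi c - psi y) by ring.
  by apply: le_lt_trans (ler_normB _ _) _; lra.
- move=> dl /= dl0 H.
  exists (dl / 2); first by rewrite divr_gt0.
  move=> x y x01 yx; apply: (H (dl / 2)) => //=.
  - by rewrite sub0r normrN gtr0_norm ?divr_gt0//; lra.
  - by rewrite divr_gt0.
Qed.

Theorem weierstrass_unit_interval (psi : R -> R) (M e : R) :
  continuous psi -> (forall u, 0 <= u <= 1 -> `|psi u| <= M) -> 0 < e ->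
  exists p : {poly R}, forall u, 0 <= u <= 1 -> `|psi u - p.[u]| <= e.
Proof.
move=> cpsi psiM e0.
have e20 : 0 < e / 2 by rewrite divr_gt0.
have [dl dl0 Hdl] := uniformly_continuous_unit_interval cpsi e20.
have M0 : 0 <= M by apply: le_trans (psiM 0 _); rewrite ?lexx ?ler01.
(* At distance at least [dl] the oscillation [2 * M] is at most [K * (a - u) ^+ 2]. One quadratic
   majorant thus serves all points, and its Bernstein polynomial is the variance divided by
   [n ^+ 2]. *)
pose K := 2 * M / dl ^+ 2.
have K0 : 0 <= K by rewrite /K divr_ge0 ?exprn_ge0 ?mulr_ge0 ?(ltW dl0).
have key (a u : R) : 0 <= a <= 1 -> 0 <= u <= 1 -> `|psi a - psi u| <= e / 2 + K * (a - u) ^+ 2.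
  move=> a01 u01; have [ua|ua] := ltP `|a - u| dl.
    apply: (le_trans (ltW (Hdl _ _ u01 ua))).
    by rewrite lerDl mulr_ge0// sqr_ge0.
  apply: (@le_trans _ _ (2 * M)).
    apply: (le_trans (ler_normB _ _)); have := psiM _ a01; have := psiM _ u01.
    by lra.
  apply: (@le_trans _ _ (K * (a - u) ^+ 2)); last by rewrite lerDr ltW.
  rewrite /K mulrAC ler_pdivlMr ?exprn_gt0// ler_wpM2l ?mulr_ge0//.
  by rewrite -[leRHS]real_normK ?num_real// lerXn2r ?nnegrE// ltW.
pose n := (Num.truncn (2 * K / e)).+1.
have n0 : 0 < n%:R :> R by [].
have Kn : K / n%:R <= e / 2.
  have := truncnS_gt (2 * K / e); rewrite -/n ltr_pdivrMr// => H.
  by rewrite ler_pdivrMr//; lra.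
exists (bernstein n (fun i => psi (i%:R / n%:R))) => u u01.
pose q i := K / n%:R ^+ 2 * (i%:R - n%:R * u) ^+ 2.
have qE : (bernstein n q).[u] <= e / 2.
  have := bernstein_affine n (fun i => (i%:R - n%:R * u) ^+ 2) (K / n%:R ^+ 2) 0 u.
  rewrite (_ : (fun i : nat => _ + 0) = q); last by apply/funext => i; rewrite addr0.
  move=> ->; rewrite bernstein_variance subrr expr0n/= add0r addr0.
  apply: le_trans Kn.
  rewrite (_ : _ * _ = K / n%:R * (u * (1 - u))); last by field; rewrite gt_eqF.
  have Kn0 : 0 <= K / n%:R by apply: divr_ge0 => //; exact: ltW.
  rewrite ler_piMr//.
  by have := sqr_ge0 u; have /andP[] := u01; lra.
have bnd i : (i <= n)%N -> `|psi (i%:R / n%:R) - psi u| <= e / 2 + q i.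
  move=> ni; apply: (le_trans (key _ u _ u01)).
    by rewrite divr_ge0//= ler_pdivrMr// mul1r ler_nat.
  rewrite lerD2l /q le_eqVlt; apply/orP; left; apply/eqP.
  by field; rewrite gt_eqF.
have B1 := @bernstein_le n (fun i => psi (i%:R / n%:R)) (fun i => 1 * q i + (e / 2 + psi u)) u u01.
have B2 := @bernstein_le n (fun i => -1 * q i + (psi u - e / 2)) (fun i => psi (i%:R / n%:R)) u u01.
rewrite !bernstein_affine in B1 B2.
rewrite ler_norml; apply/andP; split.
- have : (bernstein n (fun i => psi (i%:R / n%:R))).[u] <=
      1 * (bernstein n q).[u] + (e / 2 + psi u).
    by apply: B1 => // i ni; have := bnd i ni; rewrite ler_norml => /andP[]; lra.
  by lra.
- have : -1 * (bernstein n q).[u] + (psi u - e / 2) <=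
      (bernstein n (fun i => psi (i%:R / n%:R))).[u].
    by apply: B2 => // i ni; have := bnd i ni; rewrite ler_norml => /andP[]; lra.
  by lra.
Qed.

End bernstein.

(** * Integrals against the symmetrized Rayleigh law *)

Section rayleigh_integral.
Context {R : realType}.
Local Notation mu := (@lebesgue_measure R).
Local Notation ray := (@symmetrized_rayleigh R).
Local Notation pdf := (@symmetrized_rayleigh_pdf R).

Lemma symmetrized_rayleigh_dominates : ray `<< mu.
Proof.
apply/null_content_dominatesP => A mA muA0; rewrite /symmetrized_rayleigh.
apply: null_set_integral => //.
apply/measurable_funTS/measurableT_comp => //.
exact: measurable_symmetrized_rayleigh_pdf.
Qed.

Lemma integrable_symmetrized_rayleigh_pdf : mu.-integrable setT (EFin \o pdf).
Proof.
apply/integrableP; split.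
  apply/measurable_EFinP; exact: measurable_symmetrized_rayleigh_pdf.
under eq_integral do rewrite /= ger0_norm ?symmetrized_rayleigh_pdf_ge0//.
by rewrite integral_symmetrized_rayleigh_pdf ltry.
Qed.

Lemma integral_symmetrized_rayleigh (f : R -> \bar R) :
  ray.-integrable setT f ->
  (\int[ray]_x f x = \int[mu]_x (f x * (pdf x)%:E))%E.
Proof.
move=> If; have mf := measurable_int _ If.
rewrite -(Radon_Nikodym_change_of_variables symmetrized_rayleigh_dominates)//=.
apply: ae_eq_integral => //.
- apply: emeasurable_funM => //; apply: (measurable_int mu).
  by apply: Radon_Nikodym_integrable; exact: symmetrized_rayleigh_dominates.
- apply: emeasurable_funM => //=; apply/measurable_EFinP.
  exact: measurable_symmetrized_rayleigh_pdf.
- apply: ae_eqe_mul2l => /=.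
  rewrite Radon_NikodymE//=; first exact: symmetrized_rayleigh_dominates.
  move=> abmu.
  case: cid => /= h [h1 h2 h3].
  apply: integral_ae_eq => //=.
  + by apply/measurable_EFinP; exact: measurable_symmetrized_rayleigh_pdf.
  + by move=> E E01 mE; rewrite -h3.
Qed.

Lemma bounded_rayleigh_integrable (f : R -> R) (M : R) : measurable_fun setT f ->
  (forall x, `|f x| <= M) -> ray.-integrable setT (EFin \o f).
Proof.
move=> mf fM.
have Ic : ray.-integrable setT (EFin \o cst M).
  exact: finite_measure_integrable_cst.
apply: le_integrable Ic => //; first exact/measurable_EFinP.
by move=> x _ /=; rewrite lee_fin (le_trans (fM x))// ler_norm.
Qed.

(** The substitution [v = exp (- x^2)] carries the Rayleigh law to the uniform law on [[0, 1]]: on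
    the half line [x exp (- x^2) dx] is [- dv / 2], and symmetry doubles it. *)
Lemma integral_rayleigh_gauss (F f : R -> R) :
  (forall v : R, is_derive v 1 F (f v)) -> continuous f ->
  (forall v, 0 <= v <= 1 -> 0 <= f v) ->
  (\int[ray]_x (f (gauss_fun x))%:E = (F 1 - F 0)%:E)%E.
Proof.
move=> dF cf f0.
have cg := @continuous_gauss_fun R.
have g01 (x : R) : 0 <= gauss_fun x <= 1 by rewrite gauss_fun_ge0 gauss_fun_le1.
have cF : continuous F.
  by move=> y; apply: differentiable_continuous; apply/derivable1_diffP; have [] := dF y.
have cfg : continuous (fun x : R => f (gauss_fun x)).
  by move=> x; apply: continuous_comp; [exact: cg|exact: cf].
have Ifg : ray.-integrable setT (fun x => (f (gauss_fun x))%:E).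
  have cK : compact (`[0, 1]%classic : set R) by exact: segment_compact.
  have /compact_bounded[M [_ HM]] : compact (f @` `[0, 1]%classic).
    by apply: continuous_compact => //; exact: continuous_subspaceT.
  apply: (@bounded_rayleigh_integrable _ (M + 1)).
    exact: continuous_measurable_fun.
  move=> x; apply: (HM (M + 1)); first by rewrite ltrDl.
  by exists (gauss_fun x) => //=; rewrite in_itv/=.
rewrite integral_symmetrized_rayleigh//.
have ch : continuous (fun x : R => f (gauss_fun x) * pdf x).
  move=> x; apply: cvgM; first exact: cfg.
  exact: continuous_symmetrized_rayleigh_pdf.
have h0 x : 0 <= f (gauss_fun x) * pdf x.
  by rewrite mulr_ge0 ?symmetrized_rayleigh_pdf_ge0 ?f0.
under eq_integral do rewrite -EFinM.
rewrite ge0_symfun_integralT//=; last first.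
  by move=> x; rewrite /symmetrized_rayleigh_pdf/= /gauss_fun normrN sqrrN.
pose G (x : R) := - (2^-1 * F (gauss_fun x)).
have dG (x : R) : is_derive x 1 G (f (gauss_fun x) * (x * gauss_fun x)).
  have dX : is_derive x 1 (fun y : R => - y ^+ 2) (- (2 * x)).
    by apply: is_derive_eq; rewrite /GRing.scale/= mulr1 mulr_natl.
  have dg : is_derive x 1 (@gauss_fun R) (gauss_fun x * - (2 * x)).
    exact: (@is_derive1_comp R expR _ x _ _ (is_derive_expR (- x ^+ 2)) dX).
  have dFg := @is_derive1_comp R F (@gauss_fun R) x _ _ (dF (gauss_fun x)) dg.
  have -> : f (gauss_fun x) * (x * gauss_fun x) =
      - (2^-1 *: (f (gauss_fun x) * (gauss_fun x * - (2 * x)))).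
    by rewrite /GRing.scale/=; field.
  by apply: is_deriveN; apply: is_deriveZ.
have cG : continuous G.
  by move=> y; apply: differentiable_continuous; apply/derivable1_diffP; have [] := dG y.
rewrite (_ : [set x | _] = `[0, +oo[%classic); last first.
  by apply/seteqP; split => x/=; rewrite in_itv/= andbT.
rewrite (@ge0_continuous_FTC2y _ _ G _ (- (2^-1 * F 0)))//.
- rewrite /G /gauss_fun expr0n/= oppr0 expR0 -EFinB -EFinM.
  by congr EFin; field.
- by apply: continuous_subspaceT; exact: ch.
- apply: cvgN; apply: cvgMl_tmp; apply: (cvg_comp (@gauss_fun R) F).
    exact: cvg_gauss_fun.
  exact: cF.
- by apply: cvg_at_right_filter; exact: cG.
- move=> x; rewrite in_itv/= andbT => x0.
  rewrite derive1E (@derive_val _ _ _ _ _ _ _ (dG x)).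
  by rewrite /symmetrized_rayleigh_pdf gtr0_norm.
Qed.

Lemma integral_rayleigh_gaussX (n : nat) :
  (\int[ray]_x (gauss_fun x ^+ n)%:E = (n.+1%:R^-1)%:E)%E.
Proof.
pose F (v : R) := n.+1%:R^-1 * v ^+ n.+1.
have -> : n.+1%:R^-1 = F 1 - F 0 by rewrite /F expr1n expr0n/= mulr0 mulr1 subr0.
apply: (@integral_rayleigh_gauss F (fun v => v ^+ n)).
- move=> v; have -> : F = n.+1%:R^-1 \*: ((@id R) ^+ n.+1).
    by apply/funext => y; rewrite /F /= exprfctE.
  by apply: is_derive_eq; rewrite /GRing.scale/= mulr1 mulKf.
- exact: exprn_continuous.
- by move=> v /andP[v0 _]; rewrite exprn_ge0.
Qed.

Lemma integral_rayleigh_onem_gaussX (n : nat) :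
  (\int[ray]_x ((1 - gauss_fun x) ^+ n)%:E = (n.+1%:R^-1)%:E)%E.
Proof.
pose F (v : R) := - (n.+1%:R^-1 * (1 - v) ^+ n.+1).
have -> : n.+1%:R^-1 = F 1 - F 0.
  by rewrite /F subrr subr0 expr0n expr1n/= mulr0 oppr0 sub0r opprK mulr1.
apply: (@integral_rayleigh_gauss F (fun v => (1 - v) ^+ n)).
- move=> v; have -> : F = - (n.+1%:R^-1 \*: ((cst 1 - @id R) ^+ n.+1)).
    by apply/funext => y; rewrite /F /= -[RHS]/(- (_ * _)) exprfctE.
  by apply: is_derive_eq; rewrite /GRing.scale/= sub0r mulrN1 mulrN opprK mulKf.
- move=> v; apply: (cvg_comp (fun y : R => 1 - y) (fun y : R => y ^+ n)).
    by apply: cvgB; [exact: cvg_cst|exact: cvg_id].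
  exact: exprn_continuous.
- by move=> v /andP[_ v1]; rewrite exprn_ge0// subr_ge0.
Qed.

End rayleigh_integral.

(** The six shares: two for approximating the limit, one for the convergence of the polynomial
    means, one for the uniform error, and two for the empirical mean of the tail term (its limit and
    its convergence). *)
Lemma dist_via_approximation (R : realFieldType) (a1 a2 a3 a4 b c e : R) :
  `|a1 - a2| <= e / 6 + e / 6 -> `|a2 - a4| <= e / 6 -> `|c - b| <= e / 6 ->
  `|a3 - a4| <= b + e / 6 -> c <= e / 6 -> `|a1 - a3| <= e.
Proof.
rewrite !ler_norml => /andP[? ?] /andP[? ?] /andP[? ?] /andP[? ?] ?.
by apply/andP; split; lra.
Qed.

(** * Convergence of means for even test functions *)

Section even_test_functions.
Context {R : realType}.
Local Notation ray := (@symmetrized_rayleigh R).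
Local Notation g := (@gauss_fun R).

(** The even function [phi] in the variable [v = exp (- x^2)], so [x] is [sqrt (- ln v)] up to sign.
    At [v = 0], that is at infinity in [x], [phi] need not have a limit; the second factor vanishes
    there and restores continuity. The absolute values extend the function to the whole line. *)
Let cut (m : nat) (phi : R -> R) (v : R) : R :=
  phi (Num.sqrt (- ln `|v|)) * (1 - (1 - `|v|) ^+ m).

Let continuous_cut_factor m : continuous (fun v : R => 1 - (1 - `|v|) ^+ m).
Proof.
move=> v; apply: cvgB; first exact: cvg_cst.
apply: (cvg_comp (fun y : R => 1 - `|y|) (fun y : R => y ^+ m)).
  by apply: cvgB; [exact: cvg_cst|exact: norm_continuous].
exact: exprn_continuous.
Qed.

Let continuous_cut m (phi : R -> R) (M : R) : (0 < m)%N -> continuous phi ->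
  (forall x, `|phi x| <= M) -> continuous (cut m phi).
Proof.
move=> m0 cphi phiM v.
have M0 : 0 <= M := le_trans (normr_ge0 _) (phiM 0).
have [->|v0] := eqVneq v 0.
  have c0 : cut m phi 0 = 0 by rewrite /cut normr0 subr0 expr1n subrr mulr0.
  rewrite /continuous_at c0; apply/cvgrPdist_lt => e e0.
  have M1 : 0 < M + 1 by rewrite ltr_wpDl.
  have := @continuous_cut_factor m 0; rewrite /continuous_at normr0 subr0 expr1n subrr.
  move=> /cvgrPdist_lt/(_ (e / (M + 1)) (divr_gt0 e0 M1)).
  apply: filterS => u; rewrite !sub0r !normrN => H.
  rewrite /cut normrM; move: H; rewrite ltr_pdivlMr// mulrC; apply: le_lt_trans.
  by rewrite ler_wpM2r// (le_trans (phiM _))// lerDl.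
apply: cvgM; last exact: continuous_cut_factor.
apply: (cvg_comp (fun y : R => Num.sqrt (- ln `|y|)) phi); last exact: cphi.
apply: (cvg_comp (fun y : R => - ln `|y|) Num.sqrt); last exact: sqrt_continuous.
apply: cvgN; apply: (cvg_comp (fun y : R => `|y|) (@ln R) (G := nbhs `|v|)).
  exact: (@norm_continuous _ R v).
by apply: continuous_ln; rewrite normr_gt0.
Qed.

(** The truncated part of [phi] is approximated uniformly. The rest, at most [M * (1 - g x) ^+ m],
    is not uniformly small for large [x], but its means are. *)
Lemma gauss_polynomial_approximation (phi : R -> R) (M e : R) (m : nat) :
  (0 < m)%N -> continuous phi -> (forall x, `|phi x| <= M) ->
  (forall x, phi (- x) = phi x) -> 0 < e ->
  exists p : {poly R}, forall x, `|phi x - p.[g x]| <= M * (1 - g x) ^+ m + e.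
Proof.
move=> m0 cphi phiM ephi e0.
have M0 : 0 <= M := le_trans (normr_ge0 _) (phiM 0).
have cutM u : 0 <= u <= 1 -> `|cut m phi u| <= M.
  move=> /andP[u0 u1]; rewrite /cut normrM -[leRHS]mulr1 ler_pM//.
  rewrite (ger0_norm u0).
  have : 0 <= (1 - u) ^+ m by rewrite exprn_ge0// subr_ge0.
  have : (1 - u) ^+ m <= 1 by rewrite exprn_ile1//; lra.
  by rewrite ler_norml; lra.
have [p Hp] := weierstrass_unit_interval (continuous_cut m0 cphi phiM) cutM e0.
exists p => x.
have g0 : 0 < g x by exact: expR_gt0.
have g1 : g x <= 1 by exact: gauss_fun_le1.
have := Hp (g x); rewrite (ltW g0) g1 => /(_ isT) H.
have phiE : phi (Num.sqrt (- ln `|g x|)) = phi x.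
  rewrite gtr0_norm// /gauss_fun expRK opprK sqrtr_sqr.
  by have [x0|x0] := leP 0 x; [rewrite ger0_norm|rewrite ltr0_norm// ephi].
move: H; rewrite /cut phiE (gtr0_norm g0) => H.
have q0 : 0 <= (1 - g x) ^+ m by rewrite exprn_ge0// subr_ge0.
have -> : phi x - p.[g x] = phi x * (1 - g x) ^+ m +
  (phi x * (1 - (1 - g x) ^+ m) - p.[g x]) by ring.
apply: (le_trans (ler_normD _ _)); apply: lerD => //.
by rewrite normrM (ger0_norm q0) ler_wpM2r.
Qed.

Lemma all_moments_rayleigh (f : R -> R) (M : R) : measurable_fun setT f ->
  (forall x, `|f x| <= M) -> all_moments ray f.
Proof.
move=> mf fM; apply: (@all_moments_le _ _ _ _ _ (cst M)) => //.
  by move=> x /=; rewrite (le_trans (fM x))// ler_norm.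
exact: all_moments_cst.
Qed.

Lemma all_moments_gauss : all_moments ray g.
Proof.
apply: (@all_moments_rayleigh _ 1); first exact: measurable_gauss_fun.
by move=> x; rewrite ger0_norm ?gauss_fun_ge0// gauss_fun_le1.
Qed.

Variable x : nat -> nat -> R.

Definition empirical_mean N (f : R -> R) : R :=
  N.+1%:R^-1 * \sum_(k < N.+1) f (x N k).

Local Notation A N f := (empirical_mean N f).
Local Notation L f := (\int[ray]_y f y)%R.

Let A_le N (f h : R -> R) : (forall y, `|f y| <= h y) -> `|A N f| <= A N h.
Proof.
move=> fh; rewrite normrM ger0_norm ?invr_ge0// ler_wpM2l ?invr_ge0//.
by apply: (le_trans (ler_norm_sum _ _ _)); apply: ler_sum.
Qed.

Hypothesis A_gauss : forall n, A N (fun y => g y ^+ n) @[N --> \oo] --> (n.+1%:R^-1 : R).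

Lemma empirical_mean_poly_cvg (p : {poly R}) :
  A N (fun y => p.[g y]) @[N --> \oo] --> L (fun y => p.[g y]).
Proof.
have -> : L (fun y => p.[g y]) = \sum_(i < size p) p`_i * i.+1%:R^-1.
  under eq_fun do rewrite horner_coef.
  rewrite mean_sum; last first.
    move=> i; apply: all_momentsM; first exact: all_moments_cst.
    exact/all_momentsX/all_moments_gauss.
  apply: eq_bigr => i _; rewrite meanZ; last exact/all_momentsX/all_moments_gauss.
  by rewrite /Rintegral integral_rayleigh_gaussX.
rewrite (_ : (fun N => A N _) =
    (fun N => \sum_(i < size p) p`_i * A N (fun y => g y ^+ i))); last first.
  apply/funext => N; rewrite /empirical_mean.
  under eq_bigr do rewrite horner_coef.
  rewrite exchange_big/= mulr_sumr; apply: eq_bigr => i _.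
  by rewrite -mulr_sumr mulrCA.
apply: cvg_big => [|i _]; first exact: add_continuous.
apply: cvgM; first exact: cvg_cst.
exact: A_gauss.
Qed.

Lemma empirical_mean_even_cvg (phi : R -> R) (M : R) : continuous phi ->
  (forall y, `|phi y| <= M) -> (forall y, phi (- y) = phi y) ->
  A N phi @[N --> \oo] --> L phi.
Proof.
move=> cphi phiM ephi; apply/cvgrPdist_le => e e0.
have M0 : 0 <= M := le_trans (normr_ge0 _) (phiM 0).
have e60 : 0 < e / 6 by rewrite divr_gt0.
(* The mean of [M * (1 - g) ^+ m] under the Rayleigh law is [M / (m + 1)], here at most [e / 6].
   Being a polynomial in [g], it has empirical means with the same limit. *)
pose m := (Num.truncn (M / (e / 6))).+1.
have Mm : M / m.+1%:R <= e / 6.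
  have := truncnS_gt (M / (e / 6)); rewrite -/m ltr_pdivrMr// => H.
  rewrite ler_pdivrMr// mulrC (le_trans (ltW H))// ler_wpM2r ?(ltW e60)//.
  by rewrite ler_nat.
have [p Hp] := @gauss_polynomial_approximation phi M (e / 6) m isT cphi phiM ephi e60.
pose q := (1 - 'X : {poly R}) ^+ m.
have qE y : q.[g y] = (1 - g y) ^+ m.
  by rewrite horner_exp hornerD hornerN hornerX hornerC.
have Lq : L (fun y => q.[g y]) = m.+1%:R^-1.
  under eq_fun do rewrite qE.
  by rewrite /Rintegral integral_rayleigh_onem_gaussX.
have apoly (r : {poly R}) : all_moments ray (fun y => r.[g y]).
  under eq_fun do rewrite horner_coef.
  apply: all_moments_sum => i; apply: all_momentsM; first exact: all_moments_cst.
  exact/all_momentsX/all_moments_gauss.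
have aphi : all_moments ray phi.
  by apply: all_moments_rayleigh phiM; exact: continuous_measurable_fun.
have Lphi : `|L phi - L (fun y => p.[g y])| <= e / 6 + e / 6.
  rewrite -meanB//; apply: (@le_trans _ _ (L (fun y => M * q.[g y] + e / 6))).
    apply: norm_mean_le.
    - exact: all_momentsB.
    - apply: all_momentsD; last exact: all_moments_cst.
      by apply: all_momentsM; [exact: all_moments_cst|exact: apoly].
    - by move=> y; rewrite qE.
  rewrite meanD; [|by apply: all_momentsM; [exact: all_moments_cst|exact: apoly]
    |exact: all_moments_cst].
  by rewrite meanZ// Lq mean_cst lerD2r.
have Aphi N : `|A N phi - A N (fun y => p.[g y])| <=
    M * A N (fun y => q.[g y]) + e / 6.
  have -> : A N phi - A N (fun y => p.[g y]) = A N (fun y => phi y - p.[g y]).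
    by rewrite /empirical_mean sumrB mulrBr.
  have -> : M * A N (fun y => q.[g y]) + e / 6 = A N (fun y => M * q.[g y] + e / 6).
    rewrite /empirical_mean big_split/= -mulr_sumr sumr_const card_ord.
    rewrite -[_ / _ *+ N.+1]mulr_natl; move: (\sum_(_ < _) _) => S.
    have : N.+1%:R != 0 :> R by [].
    by move: (N.+1%:R) => z z0; field.
  by apply: A_le => y; rewrite qE.
have C1 := @empirical_mean_poly_cvg p.
have C2 : M * A N (fun y => q.[g y]) @[N --> \oo] --> M * m.+1%:R^-1.
  by apply: cvgM; [exact: cvg_cst|rewrite -Lq; exact: empirical_mean_poly_cvg].
move/cvgrPdist_le : C1 => /(_ _ e60) C1.
move/cvgrPdist_le : C2 => /(_ _ e60) C2.
near=> N.
have H1 : `|L (fun y => p.[g y]) - A N (fun y => p.[g y])| <= e / 6.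
  by near: N; exact: C1.
have H2 : `|M * m.+1%:R^-1 - M * A N (fun y => q.[g y])| <= e / 6.
  by near: N; exact: C2.
exact: (dist_via_approximation Lphi H1 H2 (Aphi N) Mm).
Unshelve. all: by end_near. Qed.

End even_test_functions.

(** * Weak convergence *)

Section rayleigh_symmetry.
Context {R : realType}.
Local Notation ray := (@symmetrized_rayleigh R).
Local Notation mu := (@lebesgue_measure R).
Local Notation pdf := (@symmetrized_rayleigh_pdf R).

Lemma integral_rayleighN (f : R -> R) (M : R) : continuous f ->
  (forall x, `|f x| <= M) ->
  (\int[ray]_x (f (- x))%:E = \int[ray]_x (f x)%:E)%E.
Proof.
move=> cf fM.
have mf : measurable_fun setT f by exact: continuous_measurable_fun.
have mfN : measurable_fun setT (fun x : R => f (- x)).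
  by apply: measurableT_comp => //; exact: oppr_measurable.
rewrite integral_symmetrized_rayleigh; last first.
  by apply: (@bounded_rayleigh_integrable _ _ M) => // x; exact: fM.
rewrite integral_symmetrized_rayleigh; last first.
  by apply: (@bounded_rayleigh_integrable _ _ M) => // x; exact: fM.
pose h (x : R) := ((f x)%:E * (pdf x)%:E)%E.
have mh : measurable_fun setT h.
  apply: emeasurable_funM; apply/measurable_EFinP => //.
  exact: measurable_symmetrized_rayleigh_pdf.
have hN (x : R) : h (- x) = ((f (- x))%:E * (pdf x)%:E)%E.
  by rewrite /h /symmetrized_rayleigh_pdf normrN sqrrN.
transitivity (\int[mu]_x (h \o (-%R)) x)%E; first by apply: eq_integral => x _ /=; rewrite hN.
transitivity (\int[pushforward mu (-%R : R -> measurableTypeR R)]_x h x)%E.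
  rewrite integral_pushforward//=.
  have Ic := integrableZl measurableT M integrable_symmetrized_rayleigh_pdf.
  apply: le_integrable Ic => //.
    by apply: (@measurableT_comp _ _ _ _ _ _ h) => //; exact: oppr_measurable.
  move=> x _; rewrite /comp hN /= lee_fin !normrM ler_wpM2r//.
  by rewrite (le_trans (fM _))// ler_norm.
by apply: eq_measure_integral => A mA _; exact: lebesgue_measureN.
Qed.

End rayleigh_symmetry.

Section empirical_measure_integral.
Context {R : realType}.

Lemma integral_empirical_spectral_measure n (H : 'M[R]_n) (f : R -> R) :
  measurable_fun setT f ->
  (\int[empirical_spectral_measure H]_x (f x)%:E =
  (n%:R^-1 * \sum_(i < n) f ((eigenvalues H)`_i / Num.sqrt n%:R))%:E)%E.
Proof.
have ge0 (g : R -> R) : measurable_fun setT g -> (forall x, 0 <= g x) ->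
    (\int[empirical_spectral_measure H]_x (g x)%:E =
    (n%:R^-1 * \sum_(i < n) g ((eigenvalues H)`_i / Num.sqrt n%:R))%:E)%E.
  move=> mg g0; have mEg : measurable_fun setT (EFin \o g) by exact/measurable_EFinP.
  rewrite /empirical_spectral_measure ge0_integral_mscale//; last first.
    by move=> x _; rewrite lee_fin.
  rewrite ge0_integral_measure_sum//; last by move=> x _; rewrite lee_fin.
  rewrite EFinM; congr (_ * _)%E; rewrite -sumEFin; apply: eq_bigr => i _.
  by rewrite integral_dirac// diracT mul1e.
move=> mf; rewrite integralE.
pose fp x := Num.max (f x) 0; pose fm x := Num.max (- f x) 0.
have mfp : measurable_fun setT fp by exact: measurable_maxr.
have mfm : measurable_fun setT fm.
  by apply: measurable_maxr => //; exact: measurableT_comp.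
have -> : ((fun x => (f x)%:E)^\+ = fun x => (fp x)%:E)%E.
  by apply/funext => x; rewrite funepos.unlock /fp EFin_max.
have -> : ((fun x => (f x)%:E)^\- = fun x => (fm x)%:E)%E.
  by apply/funext => x; rewrite funeneg.unlock /fm EFin_max.
rewrite !ge0//; [|by move=> x; rewrite le_max lexx orbT|by move=> x; rewrite le_max lexx orbT].
rewrite -EFinB -mulrBr -sumrB; congr (_ * _)%:E; apply: eq_bigr => i _.
by rewrite /fp /fm; case: (leP (f _) 0); case: (leP (- f _) 0); lra.
Qed.

End empirical_measure_integral.

(** * Transfer of moments from the common law to the entries *)

Section entries.
Context d (T : measurableType d) (R : realType) (P : probability T R).
Variables (p : probability (measurableTypeR R) R) (b : nat -> {RV P >-> R}).
Hypothesis b_distribution : forall (i : nat) (A : set R),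
  measurable A -> distribution P (b i) A = p A.

(* [R] and [measurableTypeR R] carry the same sigma-algebra but are distinct
   measurable types, hence the detour through the identity random variable. *)
Lemma integral_entry (g : R -> R) j : measurable_fun setT g ->
  p.-integrable setT (EFin \o g) ->
  P.-integrable setT (fun w => (g (b j w))%:E) /\
  (\int[P]_w g (b j w) = \int[p]_x g x)%R.
Proof.
move=> mg Ig.
have mid : @measurable_fun _ _ (measurableTypeR R) R setT id.
  by move=> _ A mA; rewrite setTI preimage_id.
pose X := @mfun_Sub _ _ (measurableTypeR R) R id (mem_set mid).
have law A : measurable A -> distribution P (b j) A = distribution p X A.
  by move=> mA; exact: b_distribution.
have mEg : measurable_fun setT (EFin \o g) by exact/measurable_EFinP.
have IP : P.-integrable setT (fun w => (g (b j w))%:E).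
  apply/integrableP; split; first by apply/measurable_EFinP; exact: measurableT_comp.
  have mag : measurable_fun setT (fun x => `|(g x)%:E|%E).
    by apply: measurableT_comp.
  have := @ge0_integral_distribution _ _ _ _ _ P (b j) _ mag (fun y => abse_ge0 _).
  have := @ge0_integral_distribution _ _ _ _ _ p X _ mag (fun y => abse_ge0 _).
  rewrite (@eq_measure_integral _ _ _ _ (distribution p X) (distribution P (b j))); last first.
    by move=> A mA _; exact: law.
  by rewrite /comp => -> <-; have /integrableP[] := Ig.
split => //; rewrite /Rintegral; congr fine.
transitivity (\int[distribution P (b j)]_x (g x)%:E)%E.
  by rewrite integral_distribution.
rewrite (@eq_measure_integral _ _ _ _ (distribution p X)); last first.
  by move=> A mA _; exact: law.
by rewrite integral_distribution.
Qed.

Hypothesis p_moments : forall k : nat,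
  p.-integrable [set: R] (fun x : R => (x ^+ k)%:E).

Lemma all_moments_law : all_moments p (fun x : R => x).
Proof. by apply: all_moments_of_expr => //; exact: measurable_id. Qed.

Lemma all_moments_entry j : all_moments P (b j).
Proof.
apply: all_moments_of_expr => // k.
by have [] := integral_entry j (exprn_measurable k) (p_moments k).
Qed.

Lemma mean_entry (g : R -> R) j : all_moments p g ->
  (\int[P]_w g (b j w) = \int[p]_x g x)%R.
Proof.
move=> ag; have [mg _] := ag.
by have [] := integral_entry j mg (all_moments_integrable ag).
Qed.

End entries.

Section weak_convergence.
Context {R : realType}.
Local Notation ray := (@symmetrized_rayleigh R).

Definition dft_point (b : nat -> R) (N k : nat) : R :=
  dft_norm N b k / Num.sqrt N.+1%:R.

Lemma empirical_mean_dft_gaussX (b : nat -> R) (m N : nat) :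
  empirical_mean (dft_point b) N (fun y => gauss_fun y ^+ m) =
  periodogram_laplace N.+1 m%:R b.
Proof.
rewrite /empirical_mean /periodogram_laplace; congr (_ * _).
apply: eq_bigr => k _; rewrite /gauss_fun -expRM_natl mulrN; congr (expR (- (_ * _))).
rewrite /dft_point /dft_norm expr_div_n !sqr_sqrtr ?addr_ge0 ?sqr_ge0//.
rewrite /periodogram /ndft_cos /ndft_sin !exprMn rsqrtN_sqr -/(dft_cos N b k).
by rewrite -/(dft_sin N b k) -mulrDr mulrC.
Qed.

(** With [M] a bound for [f], the spectral mean of [f] differs by at most [4 * M / N] from the mean
    of its even part [phi] over the points [sqrt Y_k], and the symmetric limit law does not
    distinguish [f] from [phi]. *)
Lemma weakly_converges_of_laplace (b : nat -> R) :
  (forall m, laplace_error m N.+1 b @[N --> \oo] --> (0 : R)) ->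
  weakly_converges (fun N => empirical_spectral_measure (circulant_hankel N b)) ray.
Proof.
move=> Hb f cf [M0 [_ HM]].
pose M := M0 + 1; have fM x : `|f x| <= M by apply: HM => //; rewrite ltrDl.
have M_ge0 : 0 <= M := le_trans (normr_ge0 _) (fM 0).
have mf : measurable_fun setT f by exact: continuous_measurable_fun.
pose phi y := (f y + f (- y)) / 2.
have cfN : continuous (fun y : R => f (- y)).
  move=> y; apply: (cvg_comp (@GRing.opp R) f); last exact: cf.
  by apply: cvgN; exact: cvg_id.
have cphi : continuous phi.
  by move=> y; apply: cvgM; [apply: cvgD; [exact: cf|exact: cfN]|exact: cvg_cst].
have phiM y : `|phi y| <= M.
  have := fM y; have := fM (- y); rewrite /phi !ler_norml.
  by move=> /andP[? ?] /andP[? ?]; apply/andP; split; lra.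
have phiN y : phi (- y) = phi y by rewrite /phi opprK addrC.
have A_gauss m : empirical_mean (dft_point b) N (fun y => gauss_fun y ^+ m)
    @[N --> \oo] --> (m.+1%:R^-1 : R).
  under eq_fun do rewrite empirical_mean_dft_gaussX.
  have H := cvgD (Hb m) (cvg_cst (m.+1%:R^-1 : R)); rewrite add0r in H.
  rewrite (_ : (fun N => periodogram_laplace N.+1 m%:R b) =
      (fun N => laplace_error m N.+1 b) \+ cst m.+1%:R^-1); first exact: H.
  by apply/funext => N; rewrite /= /laplace_error subrK.
have Aphi := empirical_mean_even_cvg A_gauss cphi phiM phiN.
have Lphi : (\int[ray]_y phi y = \int[ray]_y f y)%R.
  have af : all_moments ray f by exact: all_moments_rayleigh mf fM.
  have afN : all_moments ray (fun y : R => f (- y)).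
    apply: (@all_moments_rayleigh _ _ M) => [|y]; last exact: fM.
    exact: continuous_measurable_fun.
  have -> : (\int[ray]_y phi y = \int[ray]_y (2^-1 * (f y + f (- y))))%R.
    by apply: eq_Rintegral => y _; rewrite /phi mulrC.
  rewrite meanZ; last exact: all_momentsD.
  rewrite meanD//.
  have -> : (\int[ray]_y f (- y) = \int[ray]_y f y)%R.
    by rewrite /Rintegral (integral_rayleighN cf fM).
  by field.
have If : ray.-integrable setT (fun x => (f x)%:E).
  exact: bounded_rayleigh_integrable mf fM.
have -> : (\int[ray]_x (f x)%:E = (\int[ray]_y phi y)%R%:E)%E.
  by rewrite Lphi /Rintegral fineK//; exact: integrable_fin_num.
pose a N := N.+1%:R^-1 * \sum_(i < N.+1)
  f ((eigenvalues (circulant_hankel N.+1 b))`_i / Num.sqrt N.+1%:R).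
have dist N : `|a N - empirical_mean (dft_point b) N phi| <= 4 * M * N.+1%:R^-1.
  rewrite /a /empirical_mean -mulrBr normrM ger0_norm ?invr_ge0// [leRHS]mulrC.
  rewrite ler_wpM2l ?invr_ge0//.
  have := @sum_circulant_hankel_eigenvalues R N b
    (fun y => f (y / Num.sqrt N.+1%:R)) M (fun y => fM _).
  by under [X in _ - X]eq_bigr do rewrite mulNr.
have d0 : (fun N => a N - empirical_mean (dft_point b) N phi) @ \oo --> (0 : R).
  apply/norm_cvg0P; apply: (@squeeze_cvgr _ _ _ _ (fun=> 0) (fun N => 4 * M * N.+1%:R^-1)).
  - by apply: nearW => N; rewrite normr_ge0 dist.
  - exact: cvg_cst.
  - have H := cvgM (cvg_cst (4 * M)) (@cvg_harmonic R); rewrite mulr0 in H.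
    exact: H.
have ca : a @ \oo --> (\int[ray]_y phi y)%R.
  have H := cvgD d0 Aphi; rewrite add0r in H.
  rewrite (_ : a = (fun N => (a N - empirical_mean (dft_point b) N phi) +
      empirical_mean (dft_point b) N phi)); first exact: H.
  by apply/funext => N; rewrite subrK.
(* Sizes are shifted by one, which keeps the limit and leaves out the empty matrix. *)
rewrite -cvg_shiftS.
under eq_fun do rewrite integral_empirical_spectral_measure//.
by apply: cvg_EFin; [exact: nearW|exact: ca].
Qed.

End weak_convergence.

Theorem theorem1p1 (R : realType) (d : measure_display) (T : measurableType d)
    (P : probability T R) (p : probability (measurableTypeR R) R)
    (b : nat -> {RV P >-> R})
    (b_independent : mutually_independent b)
    (b_distribution : forall (i : nat) (A : set R),
      measurable A -> distribution P (b i) A = p A)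
    (p_moments : forall k : nat,
      p.-integrable [set: R] (fun x : R => (x ^+ k)%:E))
    (p_mean : ('E_p[fun x : R => x] = 0)%E)
    (p_variance : ('V_p[fun x : R => x] = 1)%E) :
  {ae P, forall w : T,
    weakly_converges
      (fun N : nat =>
        empirical_spectral_measure (circulant_hankel N (fun i => b i w)))
      (@symmetrized_rayleigh R)}.
Proof.
have aid := all_moments_law p_moments.
have mean0 : (\int[p]_x x)%R = 0 by move: p_mean; rewrite expectation.unlock /Rintegral => ->.
have var1 : (\int[p]_x (x ^+ 2))%R = 1.
  move: p_variance; rewrite /variance covariance.unlock p_mean => /(congr1 fine) /= <-.
  rewrite expectation.unlock /Rintegral; congr fine; apply: eq_integral => x _.
  have -> : ((id \- cst 0 : R -> R) * (id \- cst 0)) x = (x - 0) * (x - 0) by [].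
  by rewrite subr0 expr2.
have ab := all_moments_entry b_distribution p_moments.
have b_mean j : (\int[P]_w b j w)%R = 0.
  by rewrite (mean_entry b_distribution j aid).
have b_var j : (\int[P]_w (b j w ^+ 2))%R = 1.
  by rewrite (mean_entry b_distribution j (all_momentsX 2 aid)).
have weight q : all_moments p (fun x : R => (1 + x ^+ 2) ^+ q).
  apply/all_momentsX/all_momentsD; first exact: all_moments_cst.
  exact: all_momentsX aid.
have b_bound j q : (\int[P]_w ((1 + b j w ^+ 2) ^+ q))%R <=
    (\int[p]_x ((1 + x ^+ 2) ^+ q))%R.
  by rewrite (mean_entry b_distribution j (weight q)).
(* Countably many exponents [m] suffice, so a single null set serves all test functions. *)
have := ae_foralln (fun m => ae_laplace_error_cvg0 b_independent ab b_mean b_var b_bound m).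
apply: filterS => w Hw; exact: weakly_converges_of_laplace.
Qed.
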